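(* For $x>0$ and $\nu>-\frac12$ let $$P_\nu(x)=I_\nu(x)K_\nu(x),\qquad \mathcal{P}_\nu(x)=\frac{\sqrt{\pi}\,\Gamma\left(\nu+\frac{1}{2}\right)}{2x^\nu}P_\nu(x).$$ Then for each fixed $x>0$ the function $\nu\mapsto\mathcal{P}_\nu(x)$ is strictly log-convex on $\left(-\frac{1}{2},\infty\right)$.
   Context: $I_\nu$ and $K_\nu$ denote the modified Bessel functions of the first and second kind of order $\nu$, and $\Gamma$ is Euler's gamma function. A positive function is strictly log-convex if its logarithm is strictly convex. *)

(* Defs.v *)
From HB Require Import structures.
From mathcomp Require Import all_boot all_order all_algebra.
From mathcomp Require Import all_classical all_reals all_analysis.

Set Implicit Arguments.
Unset Strict Implicit.
Unset Printing Implicit Defensive.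

Import Order.TTheory GRing.Theory Num.Theory.
Import numFieldNormedType.Exports.

Local Open Scope classical_set_scope.
Local Open Scope ring_scope.

Section gamma.
Context {R : realType}.

Definition euler_integral (z : R) : R :=
  \int[@lebesgue_measure R]_(t in `]0, +oo[) (t `^ (z - 1) * expR (- t)).

(* For z <= 0 this is the continuation given by Gamma(z + 1) = z Gamma(z);
   (Num.truncn (- z)).+1 is the least n such that z + n > 0.  At the poles
   0, -1, -2, ... the convention 0^-1 = 0 gives the junk value 0. *)
Definition gamma (z : R) : R :=
  if 0 < z then euler_integral z
  else let n := (Num.truncn (- z)).+1 in
       euler_integral (z + n%:R) / \prod_(i < n) (z + i%:R).

End gamma.

Section bessel.
Context {R : realType}.

Definition besselI (nu x : R) : R :=
  limn (series (fun k : nat =>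
    (x / 2) `^ (k.*2%:R + nu) / (k`!%:R * gamma (nu + k%:R + 1)))).

Definition besselK_nonint (nu x : R) : R :=
  pi / 2 * ((besselI (- nu) x - besselI nu x) / sin (nu * pi)).

Definition besselK (nu x : R) : R :=
  if nu \is a Num.int then lim (besselK_nonint mu x @[mu --> nu^'])
  else besselK_nonint nu x.

Definition besselP (nu x : R) : R := besselI nu x * besselK nu x.

Definition calP (nu x : R) : R :=
  Num.sqrt pi * gamma (nu + 1 / 2) / (2 * x `^ nu) * besselP nu x.

End bessel.

Section convexity.
Context {R : realType}.

Definition strictly_convex_on (i : interval R) (f : R -> R) : Prop :=
  forall a b t : R, a \in i -> b \in i -> a != b -> 0 < t < 1 ->
    f (t * a + (1 - t) * b) < t * f a + (1 - t) * f b.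

Definition strictly_log_convex_on (i : interval R) (f : R -> R) : Prop :=
  (forall a : R, a \in i -> 0 < f a) /\ strictly_convex_on i (fun a => ln (f a)).

End convexity.

(* Main.v *)
Require Import Defs.
From mathcomp Require Import all_boot all_order all_algebra.
From mathcomp Require Import all_classical all_reals all_analysis.
From mathcomp Require Import measurable_realfun ring lra.

(** In terms of y = (x/2)^2, L nu = sum_k y^k / (k! Gamma(nu+k+1)) and
    M nu = int_0^oo t^(nu-1) exp(-t-y/t) dt, one has I_nu(x) = (x/2)^nu L nu and
    K_nu(x) = (x/2)^(-nu) M nu / 2, so that the function under study is
    sqrt pi / 4 * x^(-nu) * (Gamma(nu+1/2) L nu) * M nu.

    M is log-convex by Hoelder's inequality.  Gamma(nu+1/2) L nu is a series of
    positive multiples of Gamma(a) / Gamma(a+c) with a = nu + 1/2, and this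
    quotient is the limit of n^(-c) prod_(k<n) (1 + c/(a+k)), whose factors are
    strictly log-convex in a.

    The integral formula for K_nu needs no differential equation.  Both M and L
    satisfy three-term recurrences in nu, and their Casoratian
    M(nu+1) L(nu) + y M(nu) L(nu+1) is 1-periodic in nu and tends to 1 at
    infinity, hence equals 1.  Together with M(-nu) = y^(-nu) M(nu), this
    expresses M through L(nu) and L(-nu), up to the factor
    L(nu) L(-nu-1) - y L(nu+1) L(-nu), which does not depend on y and is
    therefore 1 / (Gamma(nu+1) Gamma(-nu)).  The reflection formula comes from
    Gamma(n+a) ~ Gamma(n) n^a (log-convexity) and from the sine product, which
    follows from the recurrence in n of the integrals of cos^n t cos(2 nu t)
    over [0, pi/2].  At integers, K_nu is a limit, and M is continuous because
    it is convex. *)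

Set Implicit Arguments.
Unset Strict Implicit.
Unset Printing Implicit Defensive.

Import Order.TTheory GRing.Theory Num.Theory.
Import numFieldNormedType.Exports.

Local Open Scope classical_set_scope.
Local Open Scope ring_scope.

(** * Complements of real analysis *)
Section real_complements.
Context {R : realType}.
Implicit Types (a c d l p t u v z nu : R) (f : R -> R).

Lemma gt0_powRD c u v : 0 < c -> c `^ (u + v) = c `^ u * c `^ v.
Proof. by move=> c0; rewrite powRD// (gt_eqF c0) implybT. Qed.

Lemma gt0_mulr_powRB1 c u : 0 < c -> c * c `^ (u - 1) = c `^ u.
Proof. by move=> c0; rewrite -{1}(powRr1 (ltW c0)) -gt0_powRD// subrKC. Qed.

Lemma is_derive_continuous f d t : is_derive t 1 f d -> {for t, continuous f}.
Proof. by move=> [df _]; apply/differentiable_continuous/derivable1_diffP. Qed.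

Lemma exprn_le_expR n t : 0 <= t -> t ^+ n.+1 <= n.+1`!%:R * expR t.
Proof.
move=> t0; rewrite -ler_pdivrMl ?ltr0n ?fact_gt0// mulrC.
by apply: le_trans (expR_ge1Dxn n t0); rewrite lerDr.
Qed.

Lemma powR_le_expR p : 0 <= p ->
  exists2 C : R, 0 < C & forall t, 0 < t -> t `^ p <= C * expR t.
Proof.
move=> p0; set n := Num.truncn p.
exists (n.+1`!%:R) => [|t t0]; first by rewrite ltr0n fact_gt0.
have [t1|t1] := leP 1 t.
  apply: le_trans (exprn_le_expR n (ltW t0)).
  by rewrite -(powR_mulrn _ (ltW t0)) ler_powR// ltW// truncnS_gt.
apply: (@le_trans _ _ 1); first by rewrite -(powRr0 t) ger_powR// t0 ltW.
by rewrite mulr_ege1 ?ler1n ?fact_gt0// -expR0 ler_expR ltW.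
Qed.

Lemma sqr_powR_le_expR p : 0 <= p ->
  exists2 C : R, 0 < C & forall t, 0 < t -> (1 + t `^ p) ^+ 2 <= C * expR t.
Proof.
move=> p0; have [C1 C10 powR_le] := powR_le_expR p0.
have [C2 C20 powR2_le] := powR_le_expR (addr_ge0 p0 p0).
exists (1 + 2 * C1 + C2) => [|t t0]; first by rewrite !addr_gt0// mulr_gt0.
have expR_ge1 : 1 <= expR t by rewrite -expR0 ler_expR ltW.
have := powR_le _ t0; have := powR2_le _ t0; rewrite gt0_powRD//; nra.
Qed.

Lemma normr_sin_le t : `|sin t| <= `|t|.
Proof.
wlog t0 : t / 0 <= t => [sin_le|].
  have [/sin_le//|/ltW t0] := leP 0 t.
  by rewrite -normrN -sinN -(normrN t) sin_le ?oppr_ge0.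
have [|c _] := @MVT_segment R sin cos 0 t t0 (fun u _ => is_derive_sin u).
  by apply: continuous_subspaceT; exact: continuous_sin.
by rewrite sin0 !subr0 => ->; rewrite normrM ler_piMl// cos_max.
Qed.

Lemma mul_cos_le_sin t : 0 <= t <= pi -> t * cos t <= sin t.
Proof.
move=> /andP[t0 tpi]; pose F (u : R) := sin u - u * cos u.
have dF (u : R) : is_derive u 1 F (u * sin u).
  by apply: is_derive_eq; rewrite /GRing.scale/=; ring.
have [|c] := @MVT_segment R F (fun u => u * sin u) 0 t t0 (fun u _ => dF u).
  by apply: continuous_subspaceT => u; exact: is_derive_continuous (dF u).
rewrite in_itv/= => /andP[c0 ct]; rewrite /F sin0 mul0r !subr0 -subr_ge0 => ->.
by rewrite !mulr_ge0// sin_ge0_pi// c0 (le_trans ct).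
Qed.

Lemma sin_pi_neq0 nu : nu \isn't a Num.int -> sin (nu * pi) != 0.
Proof.
move=> nu_int; set k := Num.floor nu.
have frac0 : 0 < nu - k%:~R < 1.
  rewrite ltrBlDl -intrD1 floorD1_gt andbT subr_gt0 lt_neqAle floor_le andbT.
  by apply: contraNneq nu_int => <-; exact: intr_int.
have : 0 < sin ((nu - k%:~R) * pi).
  rewrite sin_gt0_pi//; have /andP[f0 f1] := frac0.
  by rewrite mulr_gt0 ?pi_gt0//= -[ltRHS]mul1r ltr_pM2r ?pi_gt0.
move=> /lt0r_neq0; apply: contraNneq => sin_nu0.
case: k {frac0} => n; last first.
  rewrite NegzE mulrNz opprK mulrDl mulr_natl alternatingn; last exact: sinDpi.
  by rewrite sin_nu0 mulr0.
have := alternatingn (@sinDpi R) n ((nu - n%:R) * pi).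
rewrite -(mulr_natl pi) -mulrDl subrK sin_nu0 => /esym/eqP.
by rewrite mulf_eq0 signr_eq0.
Qed.

Lemma cvg_inv_pinfty : t^-1 @[t --> +oo] --> (0 : R).
Proof. by apply/gtr0_cvgV0; [exact: nbhs_pinfty_gt|exact: cvg_id]. Qed.

Lemma cvg_shift_pinfty f c l :
  f z @[z --> +oo] --> l -> f (z + c) @[z --> +oo] --> l.
Proof.
move=> fl; apply: (cvg_comp (fun z => z + c) f _ fl).
apply/cvgryPge => A; near=> z.
by rewrite -lerBlDr; near: z; apply: nbhs_pinfty_ge; exact: num_real.
Unshelve. all: by end_near. Qed.

Lemma periodic_cvg_pinfty f p l z : 0 < p ->
  periodic f p -> f u @[u --> +oo] --> l -> f z = l.
Proof.
move=> p0 f_per /cvg_pinftyP/(_ (fun n => z + p *+ n)) f_cvg.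
have : f (z + p *+ n) @[n --> \oo] --> l.
  apply: f_cvg; apply/cvgryPge => A; near=> n.
  rewrite addrC -lerBlDr -mulr_natl -ler_pdivrMr//.
  by near: n; exact: nbhs_infty_ger.
under eq_cvg do rewrite periodicn//.
by move=> /(cvg_lim (@Rhausdorff R)); rewrite (lim_cst (@Rhausdorff R)).
Unshelve. all: by end_near. Qed.

Lemma cvg_natD_div a : (n.+1%:R + a) / n.+1%:R @[n --> \oo] --> (1 : R).
Proof.
have -> : (fun n => (n.+1%:R + a) / n.+1%:R) = (fun n => 1 + a * n.+1%:R^-1).
  by apply/funext => n; rewrite mulrDl divff// pnatr_eq0.
rewrite -[X in _ --> X]addr0 -(mulr0 a); apply: cvgD; first exact: cvg_cst.
by apply: cvgM; [exact: cvg_cst|exact: cvg_harmonic].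
Qed.

Lemma cvg_powR_expRN p : 0 <= p ->
  t `^ p * expR (- t) @[t --> +oo] --> (0 : R).
Proof.
move=> p0; have [C C0 powR_le] := powR_le_expR (addr_ge0 p0 ler01).
have bound_cvg0 : C * t^-1 @[t --> +oo] --> (0 : R).
  rewrite -[X in _ --> X](mulr0 C); apply: cvgM; first exact: cvg_cst.
  exact: cvg_inv_pinfty.
apply: (squeeze_cvgr _ (cvg_cst _) bound_cvg0); near=> t.
have t0 : 0 < t by near: t; exact: nbhs_pinfty_gt.
rewrite mulr_ge0 ?powR_ge0 ?expR_ge0//= ler_pdivlMr// expRN mulrAC.
have := powR_le t t0; rewrite gt0_powRD// (powRr1 (ltW t0)).
by rewrite ler_pdivrMr ?expR_gt0.
Unshelve. all: by end_near. Qed.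

Lemma pseries0 (f : R^nat) : limn (pseries f 0) = f 0%N.
Proof.
apply: (cvg_lim (@Rhausdorff R)); rewrite -cvg_shiftS.
have -> : [sequence pseries f 0 n.+1]_n = (fun=> f 0%N).
  apply/funext => n; rewrite /pseries /series/= big_nat_recl//=.
  by rewrite big1 ?addr0 ?expr0 ?mulr1// => i _; rewrite exprS mul0r mulr0.
exact: cvg_cst.
Qed.

Lemma punctured_nbhs_nonint nu : nu \is a Num.int ->
  \forall mu \near nu^', mu \isn't a Num.int.
Proof.
move=> nu_int; have ball1 : \forall mu \near nu, `|nu - mu| < 1.
  exact: (nbhsx_ballx nu _ ltr01).
near=> mu; apply/negP => mu_int.
have : 1 <= `|nu - mu|.
  apply: norm_intr_ge1; first by rewrite rpredB.
  by rewrite subr_eq0 eq_sym; near: mu; exact: nbhs_dnbhs_neq.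
rewrite leNgt => /negP; apply; near: mu.
exact: (nbhs_dnbhs ball1).
Unshelve. all: by end_near. Qed.

End real_complements.

(** * Integrals over the positive half-line *)
Section nondecreasing_set_cvg_Rintegral.
Context d (T : measurableType d) (R : realType).
Variables (mu : {measure set T -> \bar R}) (F : (set T)^nat) (f : T -> R).
Hypotheses (ndF : nondecreasing_seq F) (mF : forall n, measurable (F n)).

Lemma nondecreasing_set_cvg_Rintegral :
  mu.-integrable (\bigcup_n F n) (EFin \o f) ->
  \int[mu]_(x in F n) f x @[n --> \oo] --> \int[mu]_(x in \bigcup_n F n) f x.
Proof.
move=> intf; have mU : measurable (\bigcup_n F n) by exact: bigcup_measurable.
have ge0_cvg (g : T -> \bar R) : mu.-integrable (\bigcup_n F n) g ->
    (forall x, 0 <= g x)%E ->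
    (\int[mu]_(x in F n) g x @[n --> \oo] -->
       \int[mu]_(x in \bigcup_n F n) g x)%E.
  move=> /(measurable_int mu) mg g0.
  apply: ge0_nondecreasing_set_cvg_integral => //.
  by move=> n; apply: measurable_funS mg => //; exact: bigcup_sup.
have intfp := integrable_funepos mU intf.
have intfn := integrable_funeneg mU intf.
rewrite /Rintegral integralE; under eq_cvg do rewrite integralE.
apply: fine_cvg; rewrite fineK; last first.
  by rewrite fin_numB !integrable_fin_num.
apply: cvgeB; [|exact: ge0_cvg..].
by rewrite fin_num_adde_defr// integrable_fin_num.
Qed.

End nondecreasing_set_cvg_Rintegral.

Section halfline_integral.
Context {R : realType}.
Local Notation mu := (@lebesgue_measure R).
Implicit Types (f g F : R -> R) (s t a b : R).

Definition halfline : set R := `]0, +oo[%classic.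

Lemma halflineE t : halfline t = (0 < t) :> Prop.
Proof. by rewrite /halfline/= in_itv/= andbT. Qed.

Lemma measurable_halfline : measurable (halfline : set (measurableTypeR R)).
Proof. exact: measurable_itv. Qed.

(* Symmetric under t |-> s^2 / t, so that this inversion maps each truncated
   integral to itself. *)
Definition exhaust_itv s (n : nat) : set R :=
  `[s / n.+2%:R, s * n.+2%:R]%classic.

Lemma exhaust_itv_lt s n : 0 < s -> 0 < s / n.+2%:R < s * n.+2%:R.
Proof.
move=> s0; rewrite divr_gt0//= ltr_pM2l// (@lt_trans _ _ 1) ?ltr1n//.
by rewrite invf_lt1 ?ltr1n.
Qed.

Lemma sub_exhaust_itv s n : 0 < s -> exhaust_itv s n `<=` halfline.
Proof.
move=> s0 t; rewrite halflineE /exhaust_itv/= in_itv/= => /andP[+ _].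
by apply: lt_le_trans; rewrite divr_gt0.
Qed.

Lemma nondecreasing_exhaust_itv s : 0 < s -> nondecreasing_seq (exhaust_itv s).
Proof.
move=> s0 m n mn; apply/subsetPset => t; rewrite /exhaust_itv/= !in_itv/=.
move=> /andP[lo_t t_hi]; apply/andP; split.
  by apply: le_trans lo_t; rewrite ler_pM2l// lef_pV2 ?posrE// ler_nat.
by apply: (le_trans t_hi); rewrite ler_pM2l// ler_nat.
Qed.

Lemma bigcup_exhaust_itv s : 0 < s -> \bigcup_n exhaust_itv s n = halfline.
Proof.
move=> s0; apply/seteqP; split => [t [n _]|t]; first exact: sub_exhaust_itv.
rewrite halflineE => t0.
have le_bound (u : R) (m : nat) : (Num.truncn u <= m)%N -> u <= m.+2%:R.
  by move=> um; rewrite ltW// (lt_le_trans (truncnS_gt u))// ler_nat ltnS leqW.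
exists (maxn (Num.truncn (t / s)) (Num.truncn (s / t))) => //.
rewrite /exhaust_itv/= in_itv/= ler_pdivrMr ?ltr0n// mulrC -ler_pdivrMr//.
by rewrite le_bound ?leq_maxr//= mulrC -ler_pdivrMr// le_bound ?leq_maxl.
Qed.

Definition continuous_pos f := forall t, 0 < t -> {for t, continuous f}.

Lemma is_derive_continuous_pos f (df : R -> R) :
  (forall t, 0 < t -> is_derive t 1 f (df t)) -> continuous_pos f.
Proof. by move=> dfE t t0; exact: is_derive_continuous (dfE t t0). Qed.

Lemma continuous_pos_measurable f :
  continuous_pos f -> measurable_fun halfline f.
Proof.
move=> cf; apply: open_continuous_measurable_fun; first exact: interval_open.
by move=> t /set_mem; rewrite halflineE; exact: cf.
Qed.

Lemma continuous_pos_within f a b : 0 < a ->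
  continuous_pos f -> {within `[a, b], continuous f}.
Proof.
move=> a0 cf; apply: continuous_in_subspaceT => t.
by rewrite inE/= in_itv/= => /andP[at_ _]; apply: cf; exact: lt_le_trans at_.
Qed.

Lemma continuous_pos_integrable_itv f a b : 0 < a ->
  continuous_pos f -> mu.-integrable `[a, b] (EFin \o f).
Proof.
move=> a0 cf; apply: continuous_compact_integrable.
  exact: segment_compact.
exact: continuous_pos_within.
Qed.

Lemma ge0_integral_exhaust_itv_cvg s f : 0 < s -> continuous_pos f ->
  (forall t, 0 < t -> 0 <= f t) ->
  (\int[mu]_(t in exhaust_itv s n) (f t)%:E @[n --> \oo] -->
    \int[mu]_(t in halfline) (f t)%:E)%E.
Proof.
move=> s0 cf f0; rewrite -(bigcup_exhaust_itv s0).
apply: ge0_nondecreasing_set_cvg_integral => //.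
- exact: nondecreasing_exhaust_itv.
- by move=> n; exact: measurable_itv.
- move=> n; apply/measurable_EFinP.
  apply: (measurable_funS measurable_halfline); first exact: sub_exhaust_itv.
  exact: continuous_pos_measurable.
- by move=> n t /(sub_exhaust_itv s0); rewrite halflineE lee_fin; exact: f0.
Qed.

Lemma Rintegral_exhaust_itv_cvg s f : 0 < s ->
  mu.-integrable halfline (EFin \o f) ->
  \int[mu]_(t in exhaust_itv s n) f t @[n --> \oo] -->
    \int[mu]_(t in halfline) f t.
Proof.
move=> s0; rewrite -(bigcup_exhaust_itv s0).
apply: nondecreasing_set_cvg_Rintegral; first exact: nondecreasing_exhaust_itv.
by move=> n; exact: measurable_itv.
Qed.

Lemma integrable_halflineZl k f : mu.-integrable halfline (EFin \o f) ->
  mu.-integrable halfline (EFin \o (fun t => k * f t)).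
Proof. exact: (integrableZl measurable_halfline). Qed.

Lemma integrable_halflineD f g : mu.-integrable halfline (EFin \o f) ->
  mu.-integrable halfline (EFin \o g) ->
  mu.-integrable halfline (EFin \o (fun t => f t + g t)).
Proof. exact: (integrableD measurable_halfline). Qed.

Lemma integrable_halflineB f g : mu.-integrable halfline (EFin \o f) ->
  mu.-integrable halfline (EFin \o g) ->
  mu.-integrable halfline (EFin \o (fun t => f t - g t)).
Proof. exact: (integrableB measurable_halfline). Qed.

Lemma integrable_halfline_le f g : continuous_pos f ->
  (forall t, 0 < t -> 0 <= f t <= g t) ->
  mu.-integrable halfline (EFin \o g) -> mu.-integrable halfline (EFin \o f).
Proof.
move=> cf fg; apply: le_integrable; first exact: measurable_halfline.
  by apply/measurable_EFinP; exact: continuous_pos_measurable.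
move=> t; rewrite halflineE => /fg /andP[f0 fgt].
by rewrite lee_fin !ger0_norm// (le_trans f0).
Qed.

Lemma le_Rintegral_halfline f g :
  mu.-integrable halfline (EFin \o f) -> mu.-integrable halfline (EFin \o g) ->
  (forall t, 0 < t -> f t <= g t) ->
  \int[mu]_(t in halfline) f t <= \int[mu]_(t in halfline) g t.
Proof.
move=> intf intg fg.
apply: le_Rintegral => //; first exact: measurable_halfline.
by move=> t; rewrite halflineE; exact: fg.
Qed.

Lemma Rintegral_halfline_gt0 f : continuous_pos f ->
  (forall t, 0 < t -> 0 < f t) -> mu.-integrable halfline (EFin \o f) ->
  0 < \int[mu]_(t in halfline) f t.
Proof.
move=> cf f0 intf.
have sub12 : `[1, 2] `<=` halfline.
  by move=> t; rewrite halflineE/= in_itv/= => /andP[+ _]; exact: lt_le_trans.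
have c12 : {within `[1, 2], continuous f} by exact: continuous_pos_within.
have [|c c12' fc_le] := @EVT_min R f 1 2 _ c12; first by rewrite ler1n.
have /f0 fc0 : 0 < c by have := sub12 _ c12'; rewrite halflineE.
apply: (lt_le_trans fc0).
have int12 := continuous_pos_integrable_itv 2 (@ltr01 R) cf.
apply: (@le_trans _ _ (\int[mu]_(t in `[1, 2]) f t)).
  have -> : f c = \int[mu]_(t in `[1, 2]) (cst (f c) t).
    rewrite Rintegral_cst/=; last exact: measurable_itv.
    rewrite lebesgue_measure_itv/= lte_fin ltr1n/=.
    by rewrite (_ : 2 - 1 = 1) ?mulr1//; lra.
  apply: le_Rintegral => //.
  apply: continuous_compact_integrable; first exact: segment_compact.
  by apply: continuous_subspaceT => ?; exact: cst_continuous.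
apply: fine_le; [exact: integrable_fin_num int12| |].
  by apply: integrable_fin_num intf; exact: measurable_halfline.
apply: ge0_subset_integral => //; first exact: measurable_halfline.
  by apply/measurable_EFinP; exact: continuous_pos_measurable.
by move=> t; rewrite halflineE lee_fin => /f0/ltW.
Qed.

Lemma Rintegral_FTC f F a b : a < b -> {within `[a, b], continuous f} ->
  (forall t, a <= t <= b -> is_derive t 1 F (f t)) ->
  \int[mu]_(t in `[a, b]) f t = F b - F a.
Proof.
move=> ab cf dF.
have cF t : a <= t <= b -> {for t, continuous F}.
  by move=> tab; exact: is_derive_continuous (dF t tab).
rewrite /Rintegral (@continuous_FTC2 _ f F)//=.
- split.
  + by move=> t /subset_itv_oo_cc; rewrite in_itv/= => tab; have := dF _ tab.
  + by apply: cvg_at_right_filter; apply: cF; rewrite lexx ltW.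
  + by apply: cvg_at_left_filter; apply: cF; rewrite lexx ltW.
- move=> t /subset_itv_oo_cc; rewrite in_itv/= => tab.
  by rewrite derive1E; have [_ ->] := dF _ tab.
Qed.

Lemma Rintegral_exhaust_itv_FTC f F n : continuous_pos f ->
  (forall t, 0 < t -> is_derive t 1 F (f t)) ->
  \int[mu]_(t in exhaust_itv 1 n) f t = F n.+2%:R - F n.+2%:R^-1.
Proof.
move=> cf dF; rewrite /exhaust_itv div1r mul1r.
have /andP[a0 ab] := exhaust_itv_lt n (@ltr01 R); rewrite div1r mul1r in a0 ab.
apply: Rintegral_FTC => //; first exact: continuous_pos_within.
by move=> t /andP[at_ _]; apply: dF; exact: lt_le_trans at_.
Qed.

Lemma Rintegral_halfline_FTC f F l0 ly : continuous_pos f ->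
  mu.-integrable halfline (EFin \o f) ->
  (forall t, 0 < t -> is_derive t 1 F (f t)) ->
  F t @[t --> 0^'+] --> l0 -> F t @[t --> +oo] --> ly ->
  \int[mu]_(t in halfline) f t = ly - l0.
Proof.
move=> cf intf dF Fl0 Fly.
suff : \int[mu]_(t in exhaust_itv 1 n) f t @[n --> \oo] --> ly - l0.
  apply: (cvg_unique (@Rhausdorff R)).
  exact: Rintegral_exhaust_itv_cvg (@ltr01 R) intf.
under eq_cvg do rewrite (Rintegral_exhaust_itv_FTC _ cf dF).
apply: cvgB.
  apply: (cvg_comp _ _ _ Fly); apply/cvgryPge => A; near=> n.
  apply: (@le_trans _ _ n%:R); last by rewrite ler_nat leqW.
  by near: n; exact: nbhs_infty_ger.
apply: (cvg_at_rightP _ _ _).1 Fl0 _ _; split=> [n|]; first by rewrite invr_gt0.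
by have := @cvg_harmonic R; rewrite -cvg_shiftS.
Unshelve. all: by end_near. Qed.

Lemma integrable_halfline_bounded_primitive f F C : continuous_pos f ->
  (forall t, 0 < t -> 0 <= f t) ->
  (forall t, 0 < t -> is_derive t 1 F (f t)) ->
  (forall t, 0 < t -> `|F t| <= C) ->
  mu.-integrable halfline (EFin \o f).
Proof.
move=> cf f0 dF FC; apply/integrableP; split.
  by apply/measurable_EFinP; exact: continuous_pos_measurable.
apply: (@le_lt_trans _ _ (C + C)%:E); last by rewrite ltry.
have -> : (\int[mu]_(t in halfline) `|(EFin \o f) t| =
           \int[mu]_(t in halfline) (f t)%:E)%E.
  apply: eq_integral => t /set_mem; rewrite halflineE => t0.
  by rewrite /= ger0_norm ?f0.
have cvgf := ge0_integral_exhaust_itv_cvg (@ltr01 R) cf f0.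
rewrite -(cvg_lim _ cvgf)//; apply: lime_le; first by apply: cvgP cvgf.
apply: nearW => n; have /andP[a0 _] := exhaust_itv_lt n (@ltr01 R).
have /integrable_fin_num : mu.-integrable (exhaust_itv 1 n) (EFin \o f).
  exact: continuous_pos_integrable_itv.
move=> /(_ (measurable_itv _))/fineK <-; rewrite lee_fin.
rewrite -/(Rintegral _ _ _) (Rintegral_exhaust_itv_FTC _ cf dF).
rewrite (le_trans (ler_norm _))// (le_trans (ler_normB _ _))//.
by rewrite lerD// FC// invr_gt0.
Qed.

End halfline_integral.

Section halfline_inversion.
Context {R : realType}.
Local Notation mu := (@lebesgue_measure R).
Variables (y : R) (y0 : 0 < y).
Implicit Types (f : R -> R) (a b t : R).

Let inversion_derive t : 0 < t ->
  is_derive t 1 (fun u => y / u) (- (y / t ^+ 2)).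
Proof.
move=> /lt0r_neq0 t0.
have := is_deriveZ y (is_deriveV t0 (is_derive_id t (1 : R))).
by rewrite scaler1 scalerN.
Qed.

Let inversion_derive1 t : 0 < t ->
  (fun u => y / u)^`()%classic t = - (y / t ^+ 2).
Proof. by move=> t0; rewrite derive1E; have [_ ->] := inversion_derive t0. Qed.

Let continuous_inversion : continuous_pos (fun u => y / u).
Proof. exact: is_derive_continuous_pos inversion_derive. Qed.

Let continuous_inversion_derive1 :
  continuous_pos ((fun u => y / u)^`()%classic).
Proof.
move=> t t0; pose df u := - (y / u ^+ 2).
suff : df u @[u --> t] --> (fun u => y / u)^`()%classic t.
  apply: cvg_trans; apply: near_eq_cvg; near=> u.
  by rewrite inversion_derive1//; near: u; exact: lt_nbhsr.
rewrite inversion_derive1//.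
apply: cvgN; apply: cvgM; first exact: cvg_cst.
by apply: cvgV; [rewrite expf_neq0 ?gt_eqF|exact: exprn_continuous].
Unshelve. all: by end_near. Qed.

Lemma integral_itv_inversion f a b : 0 < a < b -> continuous_pos f ->
  (\int[mu]_(t in `[(y / b)%R, (y / a)%R]) (f t)%:E =
   \int[mu]_(t in `[a, b]) (y / t ^+ 2 * f (y / t))%:E)%E.
Proof.
move=> /andP[a0 ab] cf; have b0 := lt_trans a0 ab.
rewrite (@integration_by_substitution_decreasing _ (fun u => y / u)) ?ltW//.
- apply: eq_integral => t /set_mem/=; rewrite in_itv/= => /andP[at_ _].
  by rewrite !fctE inversion_derive1 ?opprK 1?mulrC// (lt_le_trans a0).
- move=> u v; rewrite !in_itv/= => /andP[au _] /andP[av _] uv.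
  by rewrite ltr_pM2l// ltf_pV2// posrE (lt_le_trans a0).
- move=> t; rewrite in_itv/= => /andP[at_ _].
  by apply: continuous_inversion_derive1; exact: lt_trans at_.
- apply: cvgP; apply: cvg_at_right_filter.
  exact: continuous_inversion_derive1.
- apply: cvgP; apply: cvg_at_left_filter.
  exact: continuous_inversion_derive1.
- split.
  + move=> t; rewrite in_itv/= => /andP[at_ _].
    by have := inversion_derive (lt_trans a0 at_).
  + by apply: cvg_at_right_filter; exact: continuous_inversion.
  + by apply: cvg_at_left_filter; exact: continuous_inversion.
- by apply: continuous_pos_within; rewrite ?divr_gt0.
Qed.

Lemma ge0_integral_halfline_inversion f : continuous_pos f ->
  (forall t, 0 < t -> 0 <= f t) ->
  (\int[mu]_(t in halfline) (f t)%:E =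
   \int[mu]_(t in halfline) (y / t ^+ 2 * f (y / t))%:E)%E.
Proof.
move=> cf f0; set s := Num.sqrt y; have s0 : 0 < s by rewrite sqrtr_gt0.
have fcvg := ge0_integral_exhaust_itv_cvg s0 cf f0.
apply: (cvg_unique _ fcvg) => //.
have exhaustE n : exhaust_itv s n =
    `[y / (s * n.+2%:R), y / (s / n.+2%:R)]%classic.
  have yE : y = s * s by rewrite -expr2 sqr_sqrtr// ltW.
  have s_neq0 : s != 0 by rewrite gt_eqF.
  have lo : y / (s * n.+2%:R) = s / n.+2%:R.
    by rewrite yE invfM mulrA mulfK.
  have hi : y / (s / n.+2%:R) = s * n.+2%:R.
    by rewrite yE invf_div mulrA mulrAC mulfK.
  by rewrite lo hi.
have -> : (fun n => \int[mu]_(t in exhaust_itv s n) (f t)%:E)%E =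
    (fun n => \int[mu]_(t in exhaust_itv s n) (y / t ^+ 2 * f (y / t))%:E)%E.
  apply/funext => n.
  by rewrite {1}exhaustE integral_itv_inversion ?exhaust_itv_lt.
apply: (@ge0_integral_exhaust_itv_cvg _ _
  (fun t => y / t ^+ 2 * f (y / t))) => //.
- move=> t t0; apply: cvgM.
    apply: cvgM; first exact: cvg_cst.
    by apply: cvgV; [rewrite expf_neq0 ?gt_eqF|exact: exprn_continuous].
  apply: (continuous_comp (continuous_inversion t0)).
  by apply: cf; rewrite divr_gt0.
- by move=> t t0; rewrite mulr_ge0 ?divr_ge0 ?exprn_ge0 ?f0 ?divr_gt0 ?ltW.
Qed.

End halfline_inversion.

(** * Log-convexity *)
Definition lteif_convex_on (R : realType) (C : bool) (i : interval R)
    (f : R -> R) :=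
  forall a b l : R, a \in i -> b \in i -> a != b -> 0 < l < 1 ->
    f (l * a + (1 - l) * b) < l * f a + (1 - l) * f b ?<= if C.

Notation convex_on := (lteif_convex_on true).

(* For C = false this is convertible to strictly_log_convex_on. *)
Definition lteif_log_convex_on (R : realType) (C : bool) (i : interval R)
    (f : R -> R) :=
  (forall a, a \in i -> 0 < f a) /\ lteif_convex_on C i (fun a => ln (f a)).

Notation log_convex_on := (lteif_log_convex_on true).

Section log_convexity.
Context {R : realType}.
Implicit Types (C : bool) (i j : interval R) (f g : R -> R).
Implicit Types (u v A B a b c d l z : R).

Lemma convex_comb_itv i a b l : a \in i -> b \in i -> 0 < l < 1 ->
  l * a + (1 - l) * b \in i.
Proof.
move=> + + /andP[l0 l1]; have [ab|/ltW ba] := leP a b => ai bi.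
  by apply: (@interval_is_interval _ i a b) => //; apply/andP; split; nra.
by apply: (@interval_is_interval _ i b a) => //; apply/andP; split; nra.
Qed.

Lemma ln_weighted_geometric_mean u v l : 0 < u -> 0 < v ->
  ln (u `^ l * v `^ (1 - l)) = l * ln u + (1 - l) * ln v.
Proof. by move=> u0 v0; rewrite lnM ?posrE ?powR_gt0// !ln_powR. Qed.

Lemma weighted_amgm u v l : 0 < u -> 0 < v -> 0 < l < 1 ->
  u `^ l * v `^ (1 - l) <= l * u + (1 - l) * v.
Proof.
move=> u0 v0 /andP[l0 l1]; have l1' : 0 < 1 - l by rewrite subr_gt0.
rewrite -ler_ln ?posrE ?mulr_gt0 ?powR_gt0 ?addr_gt0 ?mulr_gt0//.
rewrite ln_weighted_geometric_mean//.
exact: (concave_ln (Itv01 (ltW l0) (ltW l1))).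
Qed.

Lemma weighted_amgm_scaled A B u v l : 0 < A -> 0 < B -> 0 < u -> 0 < v ->
  0 < l < 1 -> u `^ l * v `^ (1 - l) <=
    A `^ l * B `^ (1 - l) * (l * (u / A) + (1 - l) * (v / B)).
Proof.
move=> A0 B0 u0 v0 l01.
have -> : u `^ l * v `^ (1 - l) =
    A `^ l * B `^ (1 - l) * ((u / A) `^ l * (v / B) `^ (1 - l)).
  rewrite mulrACA -!powRM ?divr_ge0 ?ltW//.
  by rewrite ![_ * (_ / _)]mulrC !divfK ?gt_eqF.
by rewrite ler_pM2l ?mulr_gt0 ?powR_gt0// weighted_amgm ?divr_gt0.
Qed.

Lemma weighted_geometric_meanD (a1 a2 b1 b2 : R) l :
  0 < a1 -> 0 < a2 -> 0 < b1 -> 0 < b2 -> 0 < l < 1 ->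
  a1 `^ l * b1 `^ (1 - l) + a2 `^ l * b2 `^ (1 - l) <=
  (a1 + a2) `^ l * (b1 + b2) `^ (1 - l).
Proof.
move=> a10 a20 b10 b20 l01.
have A0 := addr_gt0 a10 a20; have B0 := addr_gt0 b10 b20.
apply: le_trans (lerD (weighted_amgm_scaled A0 B0 a10 b10 l01)
  (weighted_amgm_scaled A0 B0 a20 b20 l01)) _.
rewrite -mulrDr [leLHS](_ : _ = (a1 + a2) `^ l * (b1 + b2) `^ (1 - l))//.
by rewrite -[RHS]mulr1; congr (_ * _); field; rewrite !gt_eqF.
Qed.

Lemma lteif_log_convex_onP C i f : (forall a, a \in i -> 0 < f a) ->
  lteif_log_convex_on C i f <->
  forall a b l, a \in i -> b \in i -> a != b -> 0 < l < 1 ->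
    f (l * a + (1 - l) * b) < f a `^ l * f b `^ (1 - l) ?<= if C.
Proof.
move=> f0; have lnE a b l : a \in i -> b \in i -> 0 < l < 1 ->
    (f (l * a + (1 - l) * b) < f a `^ l * f b `^ (1 - l) ?<= if C) =
    (ln (f (l * a + (1 - l) * b)) < l * ln (f a) + (1 - l) * ln (f b) ?<= if C).
  move=> ai bi l01; have m0 := f0 _ (convex_comb_itv ai bi l01).
  rewrite -ln_weighted_geometric_mean ?f0//.
  have g0 : 0 < f a `^ l * f b `^ (1 - l) by rewrite mulr_gt0 ?powR_gt0 ?f0.
  by case: C => /=; [rewrite ler_ln|rewrite ltr_ln].
split=> [[_ cf] a b l ai bi ab l01|cf]; first by rewrite lnE//; exact: cf.
by split=> // a b l ai bi ab l01; rewrite -lnE//; exact: cf.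
Qed.

Lemma eq_lteif_log_convex_on C i f g : {in i, f =1 g} ->
  lteif_log_convex_on C i f -> lteif_log_convex_on C i g.
Proof.
move=> fg [f0 cf]; split=> [a ai|a b l ai bi ab l01]; first by rewrite -fg ?f0.
by rewrite -!fg ?convex_comb_itv//; exact: cf.
Qed.

Lemma lteif_log_convex_on_shift C i j c f :
  (forall z, z \in i -> z + c \in j) ->
  lteif_log_convex_on C j f -> lteif_log_convex_on C i (fun z => f (z + c)).
Proof.
move=> ij [f0 cf]; split=> [a /ij /f0//|a b l ai bi ab l01].
have -> : l * a + (1 - l) * b + c = l * (a + c) + (1 - l) * (b + c) by ring.
by apply: cf => //; rewrite ?ij// (inj_eq (addIr _)).
Qed.

Lemma lteif_log_convex_onM C1 C2 i f g : lteif_log_convex_on C1 i f ->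
  lteif_log_convex_on C2 i g ->
  lteif_log_convex_on (C1 && C2) i (fun z => f z * g z).
Proof.
move=> [f0 cf] [g0 cg]; split=> [a ai|a b l ai bi ab l01].
  by rewrite mulr_gt0 ?f0 ?g0.
rewrite !lnM ?posrE ?f0 ?g0 ?convex_comb_itv//.
set m := l * a + (1 - l) * b.
have -> : l * (ln (f a) + ln (g a)) + (1 - l) * (ln (f b) + ln (g b)) =
    l * ln (f a) + (1 - l) * ln (f b) + (l * ln (g a) + (1 - l) * ln (g b)).
  by ring.
apply: (lteif_trans (y := l * ln (f a) + (1 - l) * ln (f b) + ln (g m))).
  by rewrite lteifD2r; exact: cf.
by rewrite lteifD2l; exact: cg.
Qed.

Lemma strictly_log_convex_onM i f g : strictly_log_convex_on i f ->
  log_convex_on i g -> strictly_log_convex_on i (fun z => f z * g z).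
Proof. exact: (@lteif_log_convex_onM false true). Qed.

Lemma lteif_log_convex_onD C1 C2 i f g : lteif_log_convex_on C1 i f ->
  lteif_log_convex_on C2 i g ->
  lteif_log_convex_on (C1 && C2) i (fun z => f z + g z).
Proof.
move=> cf cg; have f0 := cf.1; have g0 := cg.1.
move: cf cg => /(lteif_log_convex_onP _ f0) cf /(lteif_log_convex_onP _ g0) cg.
apply/lteif_log_convex_onP => [a ai|a b l ai bi ab l01].
  by rewrite addr_gt0 ?f0 ?g0.
rewrite -[C1 && C2]andbT; apply: lteif_trans; last first.
  by apply: weighted_geometric_meanD => //; rewrite ?f0 ?g0.
apply: (lteif_trans (y := f a `^ l * f b `^ (1 - l) + g (l * a + (1 - l) * b))).
  by rewrite lteifD2r; exact: cf.
by rewrite lteifD2l; exact: cg.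
Qed.

Lemma log_convex_on_cst i c : 0 < c -> log_convex_on i (fun=> c).
Proof.
by move=> c0; split=> // a b l _ _ _ _ /=; rewrite -mulrDl subrKC mul1r.
Qed.

Lemma lteif_log_convex_onZ C i c f : 0 < c -> lteif_log_convex_on C i f ->
  lteif_log_convex_on C i (fun z => c * f z).
Proof.
by move=> c0; exact: (lteif_log_convex_onM (log_convex_on_cst i c0)).
Qed.

Lemma log_convex_on_powR i c : 0 < c -> log_convex_on i (fun z => c `^ z).
Proof.
move=> c0; split=> [a _|a b l _ _ _ _ /=]; first exact: powR_gt0.
by rewrite !ln_powR mulrDl !mulrA.
Qed.

Lemma log_convex_on_prod i (F : nat -> R -> R) n :
  (forall k, log_convex_on i (F k)) ->
  log_convex_on i (fun z => \prod_(k < n) F k z).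
Proof.
move=> cF; elim: n => [|n ih].
  apply: (eq_lteif_log_convex_on (f := fun=> 1)); last exact: log_convex_on_cst.
  by move=> z _; rewrite big_ord0.
apply: (eq_lteif_log_convex_on (f := fun z => \prod_(k < n) F k z * F n z)).
  by move=> z _; rewrite big_ord_recr.
exact: lteif_log_convex_onM ih (cF n).
Qed.

Lemma log_convex_on_sum i (F : nat -> R -> R) n :
  (forall k, log_convex_on i (F k)) ->
  log_convex_on i (fun z => \sum_(k < n.+1) F k z).
Proof.
move=> cF; elim: n => [|n ih].
  by apply: (eq_lteif_log_convex_on (f := F 0%N)) => // z _; rewrite big_ord1.
apply: (eq_lteif_log_convex_on
  (f := fun z => \sum_(k < n.+1) F k z + F n.+1 z)).
  by move=> z _; rewrite [in RHS]big_ord_recr.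
exact: lteif_log_convex_onD ih (cF n.+1).
Qed.

Lemma log_convex_on_lim i (F : nat -> R -> R) f :
  (forall z, z \in i -> 0 < f z) ->
  (forall z, z \in i -> F n z @[n --> \oo] --> f z) ->
  (forall n, log_convex_on i (F n)) -> log_convex_on i f.
Proof.
move=> f0 Ff cF; split=> // a b l ai bi ab l01.
have lnF z : z \in i -> ln (F n z) @[n --> \oo] --> ln (f z).
  move=> zi; apply: continuous_cvg; last exact: Ff.
  by apply: continuous_ln; exact: f0.
apply: (ler_cvg_to (lnF _ (convex_comb_itv ai bi l01))).
  by apply: cvgD; (apply: cvgM; [exact: cvg_cst|exact: lnF]).
by apply: nearW => n; exact: (cF n).2.
Qed.

Lemma lteif_log_convex_on_series C i (F : nat -> R -> R) :
  lteif_log_convex_on C i (F 0%N) ->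
  (forall k, log_convex_on i (F k.+1)) ->
  (forall z, z \in i -> cvgn (series (F ^~ z))) ->
  lteif_log_convex_on C i (fun z => limn (series (F ^~ z))).
Proof.
move=> cF0 cF Fcvg; pose tail z := limn (series (F ^~ z)) - F 0%N z.
have tail_cvg z : z \in i -> \sum_(k < n.+1) F k.+1 z @[n --> \oo] --> tail z.
  move=> zi.
  have -> : (fun n => \sum_(k < n.+1) F k.+1 z) =
      (fun n => series (F ^~ z) n.+2 - F 0%N z).
    apply/funext => n.
    by rewrite /series/= big_mkord [in RHS]big_ord_recl/= addrC addKr.
  apply: cvgB; last exact: cvg_cst.
  by have := Fcvg _ zi; rewrite -cvg_shiftS -cvg_shiftS.
have F_gt0 k z : z \in i -> 0 < F k.+1 z by exact: (cF k).1.
have tail_gt0 z : z \in i -> 0 < tail z.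
  move=> zi; apply: (@lt_le_trans _ _ (F 1%N z)); first exact: F_gt0.
  rewrite -(cvg_lim (@Rhausdorff R) (tail_cvg _ zi)); apply: limr_ge.
    by apply: cvgP; exact: tail_cvg.
  apply: nearW => n; rewrite big_ord_recl lerDl sumr_ge0// => k _.
  by rewrite ltW ?F_gt0.
have ctail : log_convex_on i tail.
  apply: (log_convex_on_lim tail_gt0 tail_cvg) => n.
  exact: (log_convex_on_sum _ cF).
apply: (eq_lteif_log_convex_on (f := fun z => F 0%N z + tail z)).
  by move=> z _; rewrite subrKC.
by rewrite -[C]andbT; exact: lteif_log_convex_onD.
Qed.

Lemma strictly_log_convex_on_ratio c : 0 < c ->
  strictly_log_convex_on `]0, +oo[ (fun z => (z + c) / z).
Proof.
move=> c0; split=> [a|a b l]; rewrite !in_itv/= !andbT.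
  by move=> a0; rewrite divr_gt0 ?addr_gt0.
move=> a0 b0 ab l01.
have m0 : 0 < l * a + (1 - l) * b.
  by have := @convex_comb_itv `]0, +oo[ a b l; rewrite !in_itv/= !andbT; exact.
have lnVE z : 0 < z -> ln ((z + c) / z) = - ln (z / (z + c)).
  by move=> z0; rewrite -invf_div lnV// posrE divr_gt0 ?addr_gt0.
have q0 z : 0 < z -> 0 < z / (z + c) by move=> z0; rewrite divr_gt0 ?addr_gt0.
rewrite !lnVE// !mulrN -opprD ltrN2 -ln_weighted_geometric_mean ?q0//.
rewrite ltr_ln ?posrE ?q0 ?mulr_gt0 ?powR_gt0 ?q0//.
apply: le_lt_trans (weighted_amgm (q0 _ a0) (q0 _ b0) l01) _.
set m := l * a + (1 - l) * b in m0 *; rewrite -subr_gt0.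
have mc0 := addr_gt0 m0 c0.
have ac0 := addr_gt0 a0 c0; have bc0 := addr_gt0 b0 c0.
have -> : m / (m + c) - (l * (a / (a + c)) + (1 - l) * (b / (b + c))) =
    l * (1 - l) * c * (a - b) ^+ 2 / ((m + c) * (a + c) * (b + c)).
  by rewrite /m; field; rewrite -/m !gt_eqF.
have /andP[l0 l1] := l01; have l1' : 0 < 1 - l by rewrite subr_gt0.
have ab2 : 0 < (a - b) ^+ 2 by rewrite exprn_even_gt0//= subr_eq0.
by apply: divr_gt0; do ![apply: mulr_gt0 => //].
Qed.

Lemma log_convex_onW C i f :
  lteif_log_convex_on C i f -> log_convex_on i f.
Proof. by move=> [f0 cf]; split=> // a b l ai bi ab l01; apply/lteifW/cf. Qed.

Lemma log_convex_on_convex i f : log_convex_on i f -> convex_on i f.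
Proof.
move=> cf a b l ai bi ab l01; have f0 := cf.1.
move: cf => /(lteif_log_convex_onP _ f0)/(_ _ _ _ ai bi ab l01) cf.
by apply: (le_trans cf); rewrite weighted_amgm ?f0.
Qed.

Lemma convex_on_dist i f z u l : convex_on i f -> z \in i ->
  z + u \in i -> z - u \in i -> u != 0 -> 0 < l < 1 ->
  `|f (z + l * u) - f z| <= l * (`|f (z + u) - f z| + `|f (z - u) - f z|).
Proof.
move=> cf zi zui zNui u0 /andP[l0 l1].
have l1p : 0 < 1 + l by rewrite addr_gt0.
have combE : z + l * u = l * (z + u) + (1 - l) * z by ring.
have ub : f (z + l * u) <= l * f (z + u) + (1 - l) * f z.
  by rewrite combE; apply: cf; rewrite ?l0// -subr_eq0 addrAC subrr add0r.
have zlui : z + l * u \in i by rewrite combE convex_comb_itv ?l0.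
have lb : (1 + l) * f z <= f (z + l * u) + l * f (z - u).
  have {1}-> : z = (1 + l)^-1 * (z + l * u) + (1 - (1 + l)^-1) * (z - u).
    by field; rewrite gt_eqF.
  have -> : f (z + l * u) + l * f (z - u) = (1 + l) *
      ((1 + l)^-1 * f (z + l * u) + (1 - (1 + l)^-1) * f (z - u)).
    by field; rewrite gt_eqF.
  rewrite ler_pM2l//; apply: cf => //.
    have lu_neq0 : (1 + l) * u != 0 by rewrite mulf_neq0// gt_eqF.
    by rewrite -subr_eq0 (_ : _ - _ = (1 + l) * u) ?lu_neq0//; ring.
  by rewrite invr_gt0 l1p invf_lt1// ltrDl.
have := ler_norm (f (z + u) - f z); have := ler_norm (f (z - u) - f z).
have := normr_ge0 (f (z + u) - f z); have := normr_ge0 (f (z - u) - f z).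
by move=> ? ? ? ?; rewrite ler_norml; apply/andP; split; nra.
Qed.

Lemma convex_on_continuous i f z d : convex_on i f -> 0 < d ->
  z \in i -> z + d \in i -> z - d \in i -> {for z, continuous f}.
Proof.
move=> cf d0 zi zdi zNdi.
set K := `|f (z + d) - f z| + `|f (z - d) - f z|.
have lip w : `|w - z| < d -> `|f w - f z| <= `|w - z| / d * K.
  have [->|wz wzd] := eqVneq w z; first by rewrite !subrr !normr0 !mul0r.
  have wz0 : 0 < `|w - z| by rewrite normr_gt0 subr_eq0.
  have l01 : 0 < `|w - z| / d < 1.
    by rewrite divr_gt0//= ltr_pdivrMr// mul1r.
  have [zw|zw] := leP 0 (w - z).
    have {1}-> : w = z + `|w - z| / d * d.
      by rewrite divfK ?gt_eqF// ger0_norm// subrKC.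
    by apply: (convex_on_dist cf); rewrite ?gt_eqF.
  have {1}-> : w = z + `|w - z| / d * - d.
    by rewrite mulrN divfK ?gt_eqF// ltr0_norm// opprK subrKC.
  have -> : K = `|f (z + - d) - f z| + `|f (z - - d) - f z|.
    by rewrite opprK addrC.
  by apply: (convex_on_dist cf); rewrite ?opprK ?oppr_eq0 ?gt_eqF.
have bound_cvg0 : `|w - z| / d * K @[w --> z] --> (0 : R).
  rewrite -[X in _ --> X](_ : 0 / d * K = 0); last by rewrite !mul0r.
  apply: cvgM; last exact: cvg_cst.
  apply: cvgM; last exact: cvg_cst.
  by apply/norm_cvg0P/subr_cvg0; exact: cvg_id.
apply/subr_cvg0/norm_cvg0P.
apply: (squeeze_cvgr _ (cvg_cst _) bound_cvg0).
by near=> w; rewrite normr_ge0/= lip// distrC; near: w.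
Unshelve. all: by end_near. Qed.

(* Hoelder's inequality: AM-GM for the integrands, scaled by their integrals
   A and B. *)
Lemma log_convex_on_Rintegral (disp : measure_display)
    (T : measurableType disp) (mu : {measure set T -> \bar R}) (D : set T)
    i (k : R -> T -> R) :
  measurable D -> (forall z, z \in i -> mu.-integrable D (EFin \o k z)) ->
  (forall t, D t -> log_convex_on i (k ^~ t)) ->
  (forall z, z \in i -> 0 < \int[mu]_(t in D) k z t) ->
  log_convex_on i (fun z => \int[mu]_(t in D) k z t).
Proof.
move=> mD ki ck k0; apply/lteif_log_convex_onP => // a b l ai bi ab l01.
set A := \int[mu]_(t in D) k a t; set B := \int[mu]_(t in D) k b t.
have A0 : 0 < A by exact: k0.
have B0 : 0 < B by exact: k0.
pose G := A `^ l * B `^ (1 - l).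
pose h t := G * (l / A) * k a t + G * ((1 - l) / B) * k b t.
have iA : mu.-integrable D (EFin \o (fun t => G * (l / A) * k a t)).
  exact: (integrableZl mD _ (ki a ai)).
have iB : mu.-integrable D (EFin \o (fun t => G * ((1 - l) / B) * k b t)).
  exact: (integrableZl mD _ (ki b bi)).
have kh t : D t -> k (l * a + (1 - l) * b) t <= h t.
  move=> Dt; have kt0 := (ck t Dt).1.
  move: (ck t Dt) => /(lteif_log_convex_onP _ kt0)/(_ _ _ _ ai bi ab l01).
  move=> /le_trans; apply.
  have -> : h t = G * (l * (k a t / A) + (1 - l) * (k b t / B)).
    by rewrite /h; ring.
  by rewrite weighted_amgm_scaled ?kt0.
have ih : mu.-integrable D (EFin \o h) by exact: (integrableD mD iA iB).
have im := ki _ (convex_comb_itv ai bi l01).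
apply: (le_trans (le_Rintegral mD im ih kh)).
rewrite /h RintegralD// !RintegralZl ?ki// -/A -/B [leLHS](_ : _ = G)//.
by clearbody A B; rewrite /G; field; rewrite !gt_eqF.
Qed.

End log_convexity.

(** * The Macdonald integral *)
Section macdonald.
Context {R : realType}.
Local Notation mu := (@lebesgue_measure R).
Implicit Types (i : interval R) (y z t p : R).

(* The case y = 0 is Euler's integral for the Gamma function. *)
Definition macdonald_kernel y z t : R := t `^ (z - 1) * expR (- t - y / t).

Definition macdonald y z : R :=
  \int[mu]_(t in halfline) macdonald_kernel y z t.

Definition macdonald_dom y z := (0 < y) || (y == 0) && (0 < z).

Lemma macdonald_dom_gt0 y z : 0 < y -> macdonald_dom y z.
Proof. by rewrite /macdonald_dom => ->. Qed.

Lemma macdonald_dom0 z : 0 < z -> macdonald_dom 0 z.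
Proof. by rewrite /macdonald_dom eqxx => ->; rewrite orbT. Qed.

Lemma macdonald_domS y z : macdonald_dom y z -> macdonald_dom y (z + 1).
Proof.
case/orP => [/macdonald_dom_gt0//|/andP[/eqP-> z0]].
by rewrite macdonald_dom0 ?addr_gt0.
Qed.

Lemma macdonald_kernel0 z t :
  macdonald_kernel 0 z t = t `^ (z - 1) * expR (- t).
Proof. by rewrite /macdonald_kernel mul0r subr0. Qed.

Lemma macdonald_kernel_gt0 y z t : 0 < t -> 0 < macdonald_kernel y z t.
Proof. by move=> t0; rewrite mulr_gt0 ?powR_gt0 ?expR_gt0. Qed.

Lemma macdonald_kernelS y z t : 0 < t ->
  macdonald_kernel y (z + 1) t = t * macdonald_kernel y z t.
Proof.
by move=> t0; rewrite /macdonald_kernel addrK mulrA gt0_mulr_powRB1.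
Qed.

Lemma is_derive_macdonald_kernelS y z t : 0 < t ->
  is_derive t 1 (macdonald_kernel y (z + 1))
    (z * macdonald_kernel y z t + y * macdonald_kernel y (z - 1) t
       - macdonald_kernel y (z + 1) t).
Proof.
move=> t0; have t_neq0 : t != 0 by rewrite gt_eqF.
have dV : is_derive t 1 (fun u : R => u^-1) (- t ^- 2).
  by have := is_deriveV t_neq0 (is_derive_id t (1 : R)); rewrite scaler1.
have dexponent : is_derive t 1 (fun u : R => - u - y / u) (-1 + y / t ^+ 2).
  by apply: is_derive_eq; rewrite /GRing.scale/=; field.
have dexp := @is_derive1_comp _ expR (fun u : R => - u - y / u) t _ _
  (is_derive_expR _) dexponent.
have dpow := is_derive1_powR z t0.
have -> : macdonald_kernel y (z + 1) =
    (fun u => u `^ z) \* (expR \o (fun u => - u - y / u)).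
  by apply/funext => u; rewrite /macdonald_kernel addrK.
apply: is_derive_eq; rewrite /macdonald_kernel /GRing.scale/=.
by rewrite -(gt0_mulr_powRB1 z t0) -(gt0_mulr_powRB1 (z - 1) t0); field.
Qed.

Lemma continuous_macdonald_kernel y z : continuous_pos (macdonald_kernel y z).
Proof.
rewrite -[z](subrK 1); apply: is_derive_continuous_pos => t.
exact: is_derive_macdonald_kernelS.
Qed.

Lemma integrable_powR_div_sqr p : 0 < p ->
  mu.-integrable halfline
    (EFin \o (fun t => p * t `^ (p - 1) / (1 + t `^ p) ^+ 2)).
Proof.
move=> p0; have den_gt0 t : 0 < 1 + t `^ p by rewrite ltr_wpDr ?powR_ge0.
have powR_cont q : continuous_pos (fun u : R => u `^ q).
  exact: is_derive_continuous_pos (is_derive1_powR q).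
apply: (@integrable_halfline_bounded_primitive _ _
  (fun t => - (1 + t `^ p)^-1) 1).
- move=> t t0; apply: cvgM.
    by apply: cvgM; [exact: cvg_cst|exact: powR_cont].
  apply: cvgV; first by rewrite expf_neq0// gt_eqF.
  by apply: cvgM; (apply: cvgD; [exact: cvg_cst|exact: powR_cont]).
- by move=> t t0; rewrite divr_ge0 ?exprn_ge0 ?mulr_ge0 ?powR_ge0// ltW.
- move=> t t0; have den_neq0 : 1 + t `^ p != 0 by rewrite gt_eqF.
  have dden : is_derive t 1 (fun u => 1 + u `^ p) (p * t `^ (p - 1)).
    have := is_deriveD (is_derive_cst (1 : R) t 1) (is_derive1_powR p t0).
    by rewrite add0r.
  have := is_deriveN (@is_deriveV _ (fun u => 1 + u `^ p) t _ _ den_neq0 dden).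
  by rewrite /GRing.scale/= mulNr opprK mulrC.
- move=> t t0; rewrite normrN ger0_norm; last by rewrite invr_ge0 ltW.
  by rewrite invf_le1// lerDl powR_ge0.
Qed.

Lemma integrable_gamma_kernel p : 0 < p ->
  mu.-integrable halfline (EFin \o macdonald_kernel 0 p).
Proof.
move=> p0; have [C C0 den_le] := sqr_powR_le_expR (ltW p0).
have := integrable_halflineZl (C / p) (integrable_powR_div_sqr p0).
apply: integrable_halfline_le; first exact: continuous_macdonald_kernel.
move=> t t0; rewrite ltW ?macdonald_kernel_gt0//= macdonald_kernel0.
have den_gt0 : 0 < 1 + t `^ p by rewrite ltr_wpDr ?powR_ge0.
have -> : C / p * (p * t `^ (p - 1) / (1 + t `^ p) ^+ 2) =
    t `^ (p - 1) * (C / (1 + t `^ p) ^+ 2) by field; rewrite !gt_eqF.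
rewrite ler_pM2l ?powR_gt0// expRN ler_pdivlMr ?exprn_gt0//.
by rewrite mulrC ler_pdivrMr ?expR_gt0// den_le.
Qed.

Lemma expRN_div_le n y t : 0 < y -> 0 < t ->
  expR (- (y / t)) <= n.+1`!%:R / y ^+ n.+1 * t ^+ n.+1.
Proof.
move=> y0 t0; have yt0 : 0 < y / t by rewrite divr_gt0.
have c0 : 0 < n.+1`!%:R / y ^+ n.+1 * t ^+ n.+1.
  by rewrite mulr_gt0 ?divr_gt0 ?exprn_gt0// ltr0n fact_gt0.
rewrite expRN -(invrK (_ * t ^+ _)) lef_pV2 ?posrE ?expR_gt0 ?invr_gt0//.
rewrite invfM invf_div mulrAC -expr_div_n.
by rewrite ler_pdivrMr ?ltr0n ?fact_gt0// [leRHS]mulrC exprn_le_expR// ltW.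
Qed.

Lemma macdonald_kernel_le y z : macdonald_dom y z ->
  exists C p : R, [/\ 0 < C, 0 < p & forall t, 0 < t ->
    macdonald_kernel y z t <= C * macdonald_kernel 0 p t].
Proof.
case/orP => [y0|/andP[/eqP -> z0]]; last first.
  by exists 1, z; split=> // t t0; rewrite mul1r.
set n := Num.truncn `|z|.
have zn : 0 < z + n.+1%:R.
  by have := truncnS_gt `|z|; have := ler_norm (- z); rewrite normrN -/n; lra.
exists (n.+1`!%:R / y ^+ n.+1), (z + n.+1%:R); split=> // [|t t0].
  by rewrite divr_gt0 ?exprn_gt0 ?ltr0n ?fact_gt0.
rewrite macdonald_kernel0 /macdonald_kernel expRD.
rewrite (addrAC z) (gt0_powRD (z - 1))// (powR_mulrn _ (ltW t0)).
rewrite [leRHS](_ : _ = t `^ (z - 1) * (expR (- t) *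
  (n.+1`!%:R / y ^+ n.+1 * t ^+ n.+1))); last by ring.
by rewrite !ler_pM2l ?powR_gt0 ?expR_gt0 ?expRN_div_le.
Qed.

Lemma integrable_macdonald_kernel y z : macdonald_dom y z ->
  mu.-integrable halfline (EFin \o macdonald_kernel y z).
Proof.
move=> /macdonald_kernel_le[C [p [_ p0 kC]]].
have := integrable_halflineZl C (integrable_gamma_kernel p0).
apply: integrable_halfline_le; first exact: continuous_macdonald_kernel.
by move=> t t0; rewrite ltW ?macdonald_kernel_gt0//= kC.
Qed.

Lemma macdonald_gt0 y z : macdonald_dom y z -> 0 < macdonald y z.
Proof.
move=> yz; apply: Rintegral_halfline_gt0.
- exact: continuous_macdonald_kernel.
- by move=> t; exact: macdonald_kernel_gt0.
- exact: integrable_macdonald_kernel.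
Qed.

Lemma macdonald_kernelS_bounds y z : macdonald_dom y z ->
  exists C p : R, [/\ 0 < C, 0 < p & forall t, 0 < t ->
    0 <= macdonald_kernel y (z + 1) t <= C * (t `^ p * expR (- t))].
Proof.
move=> /macdonald_kernel_le[C [p [C0 p0 kC]]]; exists C, p; split=> // t t0.
rewrite ltW ?macdonald_kernel_gt0//= macdonald_kernelS//.
rewrite (le_trans (ler_wpM2l (ltW t0) (kC t t0)))//.
by rewrite mulrCA -macdonald_kernelS// macdonald_kernel0 addrK.
Qed.

Lemma macdonald_kernelS_cvg0 y z : macdonald_dom y z ->
  macdonald_kernel y (z + 1) t @[t --> 0^'+] --> (0 : R).
Proof.
move=> /macdonald_kernelS_bounds[C [p [C0 p0 k_le]]].
have bound_cvg0 : C * t `^ p @[t --> 0^'+] --> (0 : R).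
  rewrite -[X in _ --> X](mulr0 C); apply: cvgM; first exact: cvg_cst.
  exact: powR_cvg0.
apply: (squeeze_cvgr _ (cvg_cst _) bound_cvg0); near=> t.
have t0 : 0 < t by near: t; exact: nbhs_right_gt.
have /andP[-> /= /le_trans] := k_le t t0; apply.
by rewrite ler_pM2l// ler_piMr ?powR_ge0// expR_le1 oppr_le0 ltW.
Unshelve. all: by end_near. Qed.

Lemma macdonald_kernelS_cvgy y z : macdonald_dom y z ->
  macdonald_kernel y (z + 1) t @[t --> +oo] --> (0 : R).
Proof.
move=> /macdonald_kernelS_bounds[C [p [C0 p0 k_le]]].
have bound_cvg0 : C * (t `^ p * expR (- t)) @[t --> +oo] --> (0 : R).
  rewrite -[X in _ --> X](mulr0 C); apply: cvgM; first exact: cvg_cst.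
  exact: cvg_powR_expRN (ltW p0).
apply: (squeeze_cvgr _ (cvg_cst _) bound_cvg0); near=> t.
by apply: k_le; near: t; exact: nbhs_pinfty_gt.
Unshelve. all: by end_near. Qed.

Lemma Rintegral_macdonald_kernelZ y z : macdonald_dom y (z + 1) ->
  mu.-integrable halfline (EFin \o (fun t => y * macdonald_kernel y z t)) /\
  \int[mu]_(t in halfline) (y * macdonald_kernel y z t) = y * macdonald y z.
Proof.
case/orP => [y0|/andP[/eqP-> _]].
  have kz := integrable_macdonald_kernel (macdonald_dom_gt0 z y0).
  split; first exact: integrable_halflineZl.
  by rewrite RintegralZl//; exact: measurable_halfline.
have -> : (fun t => 0 * macdonald_kernel 0 z t) =
    (fun t => 0 * macdonald_kernel 0 1 t) by apply/funext => t; rewrite !mul0r.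
have k1 := integrable_macdonald_kernel (macdonald_dom0 (@ltr01 R)).
split; first exact: integrable_halflineZl.
by rewrite RintegralZl ?mul0r//; exact: measurable_halfline.
Qed.

Lemma macdonald_rec y z : macdonald_dom y z ->
  macdonald y (z + 1) = z * macdonald y z + y * macdonald y (z - 1).
Proof.
move=> yz; have mh := @measurable_halfline R.
have kz := integrable_macdonald_kernel yz.
have kz1 := integrable_macdonald_kernel (macdonald_domS yz).
have [|ykz <-] := @Rintegral_macdonald_kernelZ y (z - 1).
  by rewrite subrK.
have zkz := integrable_halflineZl z kz.
have dk := @is_derive_macdonald_kernelS y z.
have sum_int := integrable_halflineD zkz ykz.
have cont_dk : continuous_pos (fun t => z * macdonald_kernel y z t +
    y * macdonald_kernel y (z - 1) t - macdonald_kernel y (z + 1) t).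
  have ck w := @continuous_macdonald_kernel y w.
  move=> t t0; apply: cvgB; last exact: ck.
  by apply: cvgD; (apply: cvgM; [exact: cvg_cst|exact: ck]).
have := Rintegral_halfline_FTC cont_dk (integrable_halflineB sum_int kz1) dk
  (macdonald_kernelS_cvg0 yz) (macdonald_kernelS_cvgy yz).
rewrite RintegralB// RintegralD// RintegralZl// subrr => /eqP.
by rewrite subr_eq0 => /eqP.
Qed.

Lemma macdonaldN y z : 0 < y -> macdonald y (- z) = y `^ (- z) * macdonald y z.
Proof.
move=> y0; have k_ge0 w t : 0 < t -> 0 <= macdonald_kernel y w t.
  by move=> t0; rewrite ltW// macdonald_kernel_gt0.
rewrite -RintegralZl; last 2 first.
- exact: measurable_halfline.
- exact: integrable_macdonald_kernel (macdonald_dom_gt0 z y0).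
rewrite /macdonald /Rintegral.
rewrite (ge0_integral_halfline_inversion y0 _ (k_ge0 _)); last first.
  exact: continuous_macdonald_kernel.
congr fine; apply: eq_integral => t /set_mem; rewrite halflineE => t0.
congr _%:E.
have y_neq0 : y != 0 by rewrite gt_eqF.
have t_neq0 : t != 0 by rewrite gt_eqF.
rewrite /macdonald_kernel.
have -> : - (y / t) - y / (y / t) = - t - y / t by field; rewrite t_neq0.
have -> : (y / t) `^ (- z - 1) = y `^ (- z - 1) * t `^ (z - 1 + 2%:R).
  rewrite powRM ?invr_ge0 ?(ltW y0) ?(ltW t0)// -(powR_inv1 (ltW t0)) -powRrM.
  by congr (_ * _ `^ _); ring.
rewrite (gt0_powRD _ _ y0) (powR_inv1 (ltW y0)).
rewrite (gt0_powRD (z - 1) _ t0) (powR_mulrn _ (ltW t0)).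
by field; rewrite t_neq0 y_neq0.
Qed.

Lemma macdonald_log_convex i y : (forall z, z \in i -> macdonald_dom y z) ->
  log_convex_on i (macdonald y).
Proof.
move=> iy; apply: log_convex_on_Rintegral => [|z zi|t|z zi].
- exact: measurable_halfline.
- exact: integrable_macdonald_kernel (iy z zi).
- rewrite halflineE => t0; rewrite /macdonald_kernel.
  apply: (@lteif_log_convex_onM _ true true).
    apply: (lteif_log_convex_on_shift (j := `]-oo, +oo[)) => //.
    exact: log_convex_on_powR.
  by apply: log_convex_on_cst; exact: expR_gt0.
- exact: macdonald_gt0 (iy z zi).
Qed.

Lemma macdonald_continuous y : 0 < y -> continuous (macdonald y).
Proof.
move=> y0 z; apply: (@convex_on_continuous _ `]-oo, +oo[ _ _ 1) => //.
apply/log_convex_on_convex/macdonald_log_convex => w _.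
exact: macdonald_dom_gt0.
Qed.

End macdonald.

(** * The Gamma function *)
Section gamma_theory.
Context {R : realType}.
Implicit Types (y z t a r : R).

Lemma gammaE z : 0 < z -> gamma z = macdonald 0 z.
Proof.
move=> z0; rewrite /gamma z0 /euler_integral /macdonald.
by apply: eq_Rintegral => t _; rewrite macdonald_kernel0.
Qed.

Lemma gamma_gt0 z : 0 < z -> 0 < gamma z.
Proof. by move=> z0; rewrite gammaE// macdonald_gt0// macdonald_dom0. Qed.

Lemma gammaS z : 0 < z -> gamma (z + 1) = z * gamma z.
Proof.
move=> z0; rewrite !gammaE ?addr_gt0// macdonald_rec ?macdonald_dom0//.
by rewrite mul0r addr0.
Qed.

Lemma gamma1 : gamma (1 : R) = 1.
Proof.
rewrite gammaE// -[RHS]add0r -[X in _ = X + _]oppr0 -[X in _ = _ + X]opprK.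
have kE : macdonald_kernel 0 1 = (fun t : R => expR (- t)).
  by apply/funext => t; rewrite macdonald_kernel0 subrr powRr0 mul1r.
apply: (@Rintegral_halfline_FTC _ _ (fun t => - expR (- t))).
- exact: continuous_macdonald_kernel.
- by apply: integrable_macdonald_kernel; exact: macdonald_dom0.
- move=> t t0; rewrite kE; apply: is_derive_eq.
  by rewrite /GRing.scale/= mulrN1 opprK.
- apply: cvgN; rewrite -[X in _ --> X]expR0 -[X in expR X]oppr0.
  apply: cvg_at_right_filter.
  apply: continuous_cvg; first exact: continuous_expR.
  by apply: cvgN; exact: cvg_id.
- apply: cvgN; have := @cvg_powR_expRN R 0 (lexx _).
  by under eq_cvg do rewrite powRr0 mul1r.
Qed.

Lemma gamma_log_convex : log_convex_on `]0, +oo[ (@gamma R).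
Proof.
apply: (@eq_lteif_log_convex_on _ _ _ (macdonald 0)) => [z|].
  by rewrite in_itv/= andbT => /gammaE.
apply: macdonald_log_convex => z; rewrite in_itv/= andbT.
exact: macdonald_dom0.
Qed.

Lemma gammaD_le z r : 0 < z -> 0 <= r <= 1 -> gamma (z + r) <= z `^ r * gamma z.
Proof.
move=> z0 /andP[]; rewrite le_eqVlt => /predU1P[<- _|r0].
  by rewrite addr0 powRr0 mul1r.
rewrite le_eqVlt => /predU1P[->|r1]; first by rewrite gammaS// powRr1// ltW.
have g0 := gamma_gt0 z0; have := gamma_log_convex.
move=> /(lteif_log_convex_onP _ (gamma_log_convex.1))/(_ (z + 1) z r).
rewrite !in_itv/= !andbT addr_gt0// z0 r0 r1.
rewrite -subr_eq0 addrAC subrr add0r oner_neq0 => /(_ isT isT isT isT).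
rewrite (_ : r * (z + 1) + _ = z + r); last by ring.
rewrite gammaS// (powRM _ (ltW z0) (ltW g0)) -mulrA -gt0_powRD// subrKC.
by rewrite (powRr1 (ltW g0)).
Qed.

(* Holds at the poles too, where the junk value gamma z = 0 makes the inverse
   equal to 0, the true value of 1 / Gamma. *)
Lemma rgamma_rec z : (gamma z)^-1 = z * (gamma (z + 1))^-1.
Proof.
have [z0|] := ltP 0 z.
  by rewrite gammaS// invfM mulrA divff ?gt_eqF// mul1r.
rewrite le_eqVlt => /predU1P[->|z0].
  rewrite mul0r /gamma ltxx oppr0 truncn0 big_ord1 addr0.
  by rewrite invr0 mulr0 invr0.
have [z1|z1] := ltP 0 (z + 1).
  rewrite {1}/gamma ltNge (ltW z0)/= (_ : Num.truncn (- z) = 0%N); last first.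
    by apply: truncn_def; rewrite oppr_ge0 (ltW z0)/=; lra.
  by rewrite big_ord1 addr0 invf_div /gamma z1.
have truncnE : Num.truncn (- z) = (Num.truncn (- (z + 1))).+1.
  have /truncn_itv/andP[lo hi] : 0 <= - (z + 1) by rewrite oppr_ge0.
  rewrite -natr1 in hi.
  apply: truncn_def; rewrite -[_.+2%:R]natr1 -[_.+1%:R]natr1.
  by apply/andP; split; lra.
rewrite /gamma !ltNge (ltW z0) z1/= truncnE; set n := Num.truncn _.
rewrite big_ord_recl addr0.
have -> : \prod_(i < n.+1) (z + (bump 0 i)%:R) =
    \prod_(i < n.+1) (z + 1 + i%:R).
  by apply: eq_bigr => i _; rewrite /bump leq0n natrD addrA.
rewrite -[n.+2%:R]natr1 (_ : z + (n.+1%:R + 1) = z + 1 + n.+1%:R); last by ring.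
by rewrite !invf_div mulrA.
Qed.

Definition pochhammer z n : R := \prod_(k < n) (z + k%:R).

Lemma pochhammer_gt0 z n : 0 < z -> 0 < pochhammer z n.
Proof. by move=> z0; apply: prodr_gt0 => k _; rewrite ltr_wpDr. Qed.

Lemma rgamma_pochhammer z n :
  (gamma z)^-1 = pochhammer z n * (gamma (z + n%:R))^-1.
Proof.
elim: n => [|n ->]; first by rewrite /pochhammer big_ord0 addr0 mul1r.
by rewrite rgamma_rec /pochhammer big_ord_recr/= mulrA -addrA natr1.
Qed.

Lemma gamma_pochhammer z n : 0 < z ->
  gamma (z + n%:R) = pochhammer z n * gamma z.
Proof.
move=> z0; apply: invr_inj; rewrite invfM (rgamma_pochhammer z n).
by rewrite mulKf// gt_eqF// pochhammer_gt0.
Qed.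

Lemma gamma_nat n : gamma n.+1%:R = pochhammer 1 n.
Proof. by rewrite -nat1r gamma_pochhammer// gamma1 mulr1. Qed.

Definition gamma_ratio a n : R :=
  gamma n.+1%:R * n.+1%:R `^ a / gamma (n.+1%:R + a).

Lemma gamma_ratio_bounds r n : 0 <= r <= 1 ->
  1 <= gamma_ratio r n <= (n.+1%:R + r) / n.+1%:R.
Proof.
move=> /[dup] r01 /andP[r0 r1]; rewrite /gamma_ratio; set N : R := n.+1%:R.
have N0 : 0 < N by [].
have Nr0 : 0 < N + r by rewrite ltr_wpDr.
have gN := gamma_gt0 N0; have gNr := gamma_gt0 Nr0.
rewrite ler_pdivlMr// mul1r mulrC gammaD_le//= ler_pdivrMr//.
rewrite -(ler_pM2l (powR_gt0 (1 - r) N0)) !mulrA -gt0_powRD// subrK.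
rewrite (powRr1 (ltW N0)).
have r01' : 0 <= 1 - r <= 1 by rewrite subr_ge0 r1 gerBl.
have := gammaD_le Nr0 r01'; rewrite -addrA subrKC gammaS// => /le_trans; apply.
rewrite ler_pM2r// -mulrA.
have -> : (N + r) `^ (1 - r) = N `^ (1 - r) * ((N + r) / N) `^ (1 - r).
  by rewrite -powRM ?divr_ge0 ?ltW// mulrC divfK ?gt_eqF.
have Nr1 : 1 <= (N + r) / N by rewrite ler_pdivlMr// mul1r lerDl.
by rewrite ler_pM2l ?powR_gt0// ler1_powR// gerBl.
Qed.

Lemma gamma_ratioS a n :
  gamma_ratio a n = (n.+1%:R + a) / n.+1%:R * gamma_ratio (a + 1) n.
Proof.
rewrite /gamma_ratio rgamma_rec addrA (gt0_powRD a)// powRr1//.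
by set rgamma := (gamma (_ + 1))^-1; field; rewrite nat1r pnatr_eq0.
Qed.

Lemma gamma_ratioS_cvg1 a :
  gamma_ratio a @ \oo --> (1 : R) <-> gamma_ratio (a + 1) @ \oo --> (1 : R).
Proof.
have quot := cvg_natD_div a; split=> ratio_cvg.
  rewrite -[X in _ --> X]divr1.
  suff : gamma_ratio a n / ((n.+1%:R + a) / n.+1%:R) @[n --> \oo]
      --> 1 / (1 : R).
    apply: cvg_trans; apply: near_eq_cvg; near=> n.
    rewrite gamma_ratioS mulrAC divff ?mul1r//.
    near: n; exact: cvgr_neq0 quot (oner_neq0 _).
  by apply: cvgM => //; apply: cvgV.
rewrite (funext (gamma_ratioS a)) -[X in _ --> X]mulr1.
by apply: cvgM.
Unshelve. all: by end_near. Qed.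

Lemma gamma_ratio_cvg1 a : gamma_ratio a @ \oo --> (1 : R).
Proof.
have frac r : 0 <= r < 1 -> gamma_ratio r @ \oo --> (1 : R).
  move=> /andP[r0 /ltW r1].
  apply: (squeeze_cvgr _ (cvg_cst _) (cvg_natD_div r)).
  by apply: nearW => n; apply: gamma_ratio_bounds; rewrite r0.
have up r n : gamma_ratio r @ \oo --> (1 : R) <->
    gamma_ratio (r + n%:R) @ \oo --> (1 : R).
  elim: n => [|n ih]; first by rewrite addr0.
  by rewrite -natr1 addrA; apply: (iff_trans ih); exact: gamma_ratioS_cvg1.
have [lo hi] : (Num.floor a)%:~R <= a /\ a < (Num.floor a)%:~R + 1.
  by have /andP[] := floor_itv a; rewrite intrD.
move: lo hi; case: (Num.floor a) => n lo hi.
  rewrite -[a](subrK n%:R); apply: (up _ n).1.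
  by apply: frac; apply/andP; split; lra.
apply: (up a n.+1).2; apply: frac; rewrite NegzE mulrNz in lo hi.
by apply/andP; split; lra.
Qed.

Lemma macdonald_le_gamma y z : 0 < y -> 0 < z -> macdonald y z <= gamma z.
Proof.
move=> y0 z0; rewrite gammaE//; apply: le_Rintegral_halfline.
- exact: integrable_macdonald_kernel (macdonald_dom_gt0 z y0).
- exact: integrable_macdonald_kernel (macdonald_dom0 z0).
- move=> t t0; rewrite macdonald_kernel0 ler_pM2l ?powR_gt0// ler_expR.
  by rewrite lerBlDr lerDl divr_ge0// ltW.
Qed.

Lemma gamma_le_macdonald y z : 0 < y -> 0 < z ->
  gamma (z + 1) - y * gamma z <= macdonald y (z + 1).
Proof.
move=> y0 z0; have z10 : 0 < z + 1 by rewrite addr_gt0.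
have iz1 := integrable_macdonald_kernel (macdonald_dom0 z10).
have iz := integrable_macdonald_kernel (macdonald_dom0 z0).
have mh := @measurable_halfline R; have iyz := integrable_halflineZl y iz.
rewrite !gammaE// /macdonald -RintegralZl// -RintegralB//.
apply: le_Rintegral_halfline; first exact: integrable_halflineB iz1 iyz.
  exact: integrable_macdonald_kernel (macdonald_dom_gt0 _ y0).
move=> t t0; rewrite !macdonald_kernelS// macdonald_kernel0.
rewrite /macdonald_kernel expRD -subr_ge0.
rewrite [leRHS](_ : _ = t `^ (z - 1) * t * expR (- t) *
  (expR (- (y / t)) - (1 + - (y / t)))); last by field; rewrite gt_eqF.
by rewrite !mulr_ge0 ?powR_ge0 ?expR_ge0 ?subr_ge0 ?expR_ge1Dx// ltW.
Qed.

Lemma macdonald_div_gamma_cvg1 y : 0 < y ->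
  macdonald y z / gamma z @[z --> +oo] --> (1 : R).
Proof.
move=> y0; have bound_cvg1 : 1 - y * (z - 1)^-1 @[z --> +oo] --> (1 : R).
  rewrite -[X in _ --> X]subr0 -[X in _ - X](mulr0 y).
  apply: cvgB; first exact: cvg_cst.
  apply: cvgM; first exact: cvg_cst.
  exact: (cvg_shift_pinfty (- 1) cvg_inv_pinfty).
apply: (squeeze_cvgr _ bound_cvg1 (cvg_cst _)); near=> z.
have z1 : 1 < z by near: z; exact: nbhs_pinfty_gt.
have z0 : 0 < z by exact: lt_trans z1.
have z10 : 0 < z - 1 by rewrite subr_gt0.
rewrite ler_pdivrMr ?gamma_gt0// mul1r macdonald_le_gamma// andbT.
have := gamma_le_macdonald y0 z10; rewrite ler_pdivlMr ?gamma_gt0// subrK.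
have -> : gamma z = (z - 1) * gamma (z - 1) by rewrite -gammaS// subrK.
apply: le_trans; rewrite [leLHS](_ : _ =
  (z - 1) * gamma (z - 1) - y * gamma (z - 1))//.
by field; rewrite gt_eqF.
Unshelve. all: by end_near. Qed.

End gamma_theory.

(** * Euler's sine product and the reflection formula *)
Section sine_product.
Context {R : realType}.
Local Notation mu := (@lebesgue_measure R).
Implicit Types (t nu c : R) (f : R -> R).

(* 1 - cos (2 nu t) = 2 sin^2 (nu t) <= 2 nu^2 t^2, and t cos t <= sin t. *)
Lemma cos_defect_le nu t : 0 <= t <= pi / 2 ->
  cos t ^+ 2 * (1 - cos (2 * nu * t)) <= 2 * nu ^+ 2 * (1 - cos t ^+ 2).
Proof.
move=> /andP[t0 t1].
have -> : 1 - cos (2 * nu * t) = 2 * sin (nu * t) ^+ 2.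
  by rewrite -mulrA mulr_natl cos_mulr2n cos2sin2; ring.
have pi2_0 : 0 <= pi / 2 :> R by rewrite divr_ge0// pi_ge0.
have tcos_ge0 : 0 <= t * cos t.
  by rewrite mulr_ge0// cos_ge0_pihalf// t1 (le_trans _ t0)// oppr_le0.
have tcos_le : (t * cos t) ^+ 2 <= 1 - cos t ^+ 2.
  have tcos_sin : t * cos t <= sin t.
    apply: mul_cos_le_sin; rewrite t0 (le_trans t1)// ler_pdivrMr//.
    by rewrite ler_peMr ?pi_ge0// ler1n.
  by rewrite -sin2cos2 ler_sqr ?nnegrE// (le_trans tcos_ge0).
have sin_le : sin (nu * t) ^+ 2 <= (nu * t) ^+ 2.
  rewrite -[leLHS]real_normK ?num_real// -[leRHS]real_normK ?num_real//.
  by rewrite ler_sqr ?nnegrE ?normr_sin_le.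
apply: (@le_trans _ _ (2 * nu ^+ 2 * (t * cos t) ^+ 2)).
  have -> : 2 * nu ^+ 2 * (t * cos t) ^+ 2 =
    cos t ^+ 2 * (2 * (nu * t) ^+ 2) by ring.
  by rewrite ler_wpM2l ?sqr_ge0// ler_wpM2l.
by rewrite ler_wpM2l// mulr_ge0 ?sqr_ge0.
Qed.

Definition cos_moment n nu : R :=
  \int[mu]_(t in `[0, pi / 2]) (cos t ^+ n * cos (2 * nu * t)).

Lemma pihalf_gt0 : 0 < pi / 2 :> R.
Proof. by rewrite divr_gt0// pi_gt0. Qed.

Lemma continuous_cos_moment n nu :
  continuous (fun t : R => cos t ^+ n * cos (2 * nu * t)).
Proof.
move=> t; apply: cvgM.
  apply: (@continuous_cvg _ _ _ _ _ cos (fun x : R => x ^+ n)).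
    exact: exprn_continuous.
  exact: continuous_cos.
apply: continuous_cvg; first exact: continuous_cos.
by apply: cvgM; [exact: cvg_cst|exact: cvg_id].
Qed.

Lemma measurable_pihalf :
  measurable (`[0, pi / 2] : set (measurableTypeR R)).
Proof. exact: measurable_itv. Qed.

Lemma integrable_pihalf f : continuous f ->
  mu.-integrable `[0, pi / 2] (EFin \o f).
Proof.
move=> cf; apply: continuous_compact_integrable; first exact: segment_compact.
exact: continuous_subspaceT.
Qed.

Lemma integrable_cos_moment n nu : mu.-integrable `[0, pi / 2]
  (EFin \o (fun t : R => cos t ^+ n * cos (2 * nu * t))).
Proof. exact/integrable_pihalf/continuous_cos_moment. Qed.

Lemma integrable_cos_momentZ c n nu : mu.-integrable `[0, pi / 2]
  (EFin \o (fun t : R => c * (cos t ^+ n * cos (2 * nu * t)))).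
Proof. exact: (integrableZl _ c (integrable_cos_moment n nu)). Qed.

Lemma is_derive_sin_scaled c t :
  is_derive t 1 (fun u : R => sin (c * u)) (c * cos (c * t)).
Proof.
have dlin : is_derive t 1 (fun u : R => c * u) c.
  by apply: is_derive_eq; rewrite /GRing.scale/= mulr1.
rewrite mulrC.
exact: (@is_derive1_comp _ sin (fun u => c * u) t _ _ (is_derive_sin _) dlin).
Qed.

Lemma is_derive_cos_scaled c t :
  is_derive t 1 (fun u : R => cos (c * u)) (- (c * sin (c * t))).
Proof.
have dlin : is_derive t 1 (fun u : R => c * u) c.
  by apply: is_derive_eq; rewrite /GRing.scale/= mulr1.
rewrite mulrC -mulNr.
exact: (@is_derive1_comp _ cos (fun u => c * u) t _ _ (is_derive_cos _) dlin).
Qed.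

Lemma is_derive_cos_exp n t :
  is_derive t 1 (fun u : R => cos u ^+ n.+1) (- (n.+1%:R * cos t ^+ n * sin t)).
Proof.
have -> : (fun u : R => cos u ^+ n.+1) = cos ^+ n.+1.
  by apply/funext => u; rewrite exprfctE.
by have := is_deriveX n.+1 (is_derive_cos t); rewrite /GRing.scale/= mulrN.
Qed.

Lemma is_derive_cos_moment_primitive n c t :
  is_derive t 1 (fun u : R => n.+2%:R * (cos u ^+ n.+1 * sin u * cos (c * u)) -
      c * (cos u ^+ n.+2 * sin (c * u)))
    ((n.+2%:R ^+ 2 - c ^+ 2) * (cos t ^+ n.+2 * cos (c * t)) -
      n.+2%:R * n.+1%:R * (cos t ^+ n * cos (c * t))).
Proof.
have dprimitive := is_deriveB
  (is_deriveM (is_derive_cst (n.+2%:R : R) t 1)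
    (is_deriveM (is_deriveM (is_derive_cos_exp n t) (is_derive_sin t))
      (is_derive_cos_scaled c t)))
  (is_deriveM (is_derive_cst c t 1)
    (is_deriveM (is_derive_cos_exp n.+1 t) (is_derive_sin_scaled c t))).
apply: (is_derive_eq dprimitive); rewrite /GRing.scale/= !fctE.
rewrite -[n.+2%:R]natr1 !exprS.
transitivity (
  (n.+1%:R + 1) * (n.+1%:R * - (sin t ^+ 2) * cos t ^+ n * cos (c * t) +
    cos t ^+ 2 * cos t ^+ n * cos (c * t)) -
  c ^+ 2 * (cos t ^+ 2 * cos t ^+ n * cos (c * t))); first by ring.
by rewrite sin2cos2; ring.
Qed.

Lemma cos_moment_rec n nu :
  (n.+2%:R ^+ 2 - (2 * nu) ^+ 2) * cos_moment n.+2 nu =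
  n.+2%:R * n.+1%:R * cos_moment n nu.
Proof.
have mI := measurable_pihalf.
have cmZ c m : continuous (fun t : R => c * (cos t ^+ m * cos (2 * nu * t))).
  by move=> t; apply: cvgM; [exact: cvg_cst|exact: continuous_cos_moment].
have := Rintegral_FTC pihalf_gt0 (continuous_subspaceT _)
  (fun t _ => is_derive_cos_moment_primitive n (2 * nu) t).
rewrite (RintegralB mI); [|exact: integrable_cos_momentZ..].
rewrite !(RintegralZl _ mI (integrable_cos_moment _ _)).
move=> /(_ (fun t => cvgB (cmZ _ _ t) (cmZ _ _ t))).
rewrite cos_pihalf sin0 !mulr0 sin0 !mulr0 !exprS !mul0r !mulr0 !subr0.
by move/eqP; rewrite subr_eq0 => /eqP.
Qed.

Lemma cos_moment0 nu : nu != 0 -> cos_moment 0 nu = sin (nu * pi) / (2 * nu).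
Proof.
move=> nu0; have nu2_neq0 : 2 * nu != 0 by rewrite mulf_neq0.
have dF t : is_derive t 1 (fun u => (2 * nu)^-1 * sin (2 * nu * u))
    (cos t ^+ 0 * cos (2 * nu * t)).
  have dsin := is_derive_sin_scaled (2 * nu) t.
  by apply: is_derive_eq; rewrite /GRing.scale/= expr0 mulrA mulVf.
rewrite /cos_moment (Rintegral_FTC pihalf_gt0 _ (fun t _ => dF t)); last first.
  exact/continuous_subspaceT/continuous_cos_moment.
by rewrite mulr0 sin0 mulr0 subr0 mulrC; congr (sin _ / _); field.
Qed.

Lemma cos_moment00 : cos_moment 0 0 = pi / 2.
Proof.
have dF t : is_derive t 1 (fun u : R => u) (cos t ^+ 0 * cos (2 * 0 * t)).
  by apply: is_derive_eq; rewrite expr0 mulr0 mul0r cos0 mulr1.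
rewrite /cos_moment (Rintegral_FTC pihalf_gt0 _ (fun t _ => dF t)) ?subr0//.
exact/continuous_subspaceT/continuous_cos_moment.
Qed.

Lemma cos_moment_even_rec n nu :
  n.*2.+2%:R * ((1 - nu ^+ 2 / n.+1%:R ^+ 2) * cos_moment n.*2.+2 nu) =
  n.*2.+1%:R * cos_moment n.*2 nu.
Proof.
have N0 : n.*2.+2%:R != 0 :> R by rewrite pnatr_eq0.
have NE : n.*2.+2%:R = 2 * n.+1%:R :> R by rewrite -doubleS -muln2 natrM mulrC.
apply: (mulfI N0); rewrite [RHS]mulrA -cos_moment_rec NE.
by field; rewrite nat1r pnatr_eq0.
Qed.

Lemma cos_moment_even_rec0 n :
  n.*2.+2%:R * cos_moment n.*2.+2 0 = n.*2.+1%:R * cos_moment n.*2 0.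
Proof. by rewrite -cos_moment_even_rec expr0n/= mul0r subr0 mul1r. Qed.

Lemma cos_moment_even_gt0 n : 0 < cos_moment n.*2 0.
Proof.
elim: n => [|n ih]; first by rewrite cos_moment00 pihalf_gt0.
by rewrite doubleS -(@pmulr_rgt0 _ n.*2.+2%:R)// cos_moment_even_rec0 mulr_gt0.
Qed.

Definition sine_product nu n : R := \prod_(k < n) (1 - nu ^+ 2 / k.+1%:R ^+ 2).

Lemma cos_moment_product nu n :
  sine_product nu n * cos_moment n.*2 nu * cos_moment 0 0 =
  cos_moment 0 nu * cos_moment n.*2 0.
Proof.
elim: n => [|n ih]; first by rewrite /sine_product big_ord0 mul1r.
have N0 : n.*2.+2%:R != 0 :> R by rewrite pnatr_eq0.
apply: (mulfI N0); rewrite doubleS [RHS]mulrCA cos_moment_even_rec0.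
rewrite /sine_product big_ord_recr/= -/(sine_product nu n).
rewrite [RHS]mulrCA -ih -!mulrA mulrCA [RHS]mulrCA; congr (_ * _).
by rewrite [RHS]mulrA -cos_moment_even_rec !mulrA.
Qed.

Lemma cos_moment_defect n nu :
  cos_moment n.*2.+2 0 - cos_moment n.*2.+2 nu <=
  2 * nu ^+ 2 / n.*2.+1%:R * cos_moment n.*2.+2 0.
Proof.
have n1_neq0 : n.*2.+1%:R != 0 :> R by rewrite pnatr_eq0.
have -> : 2 * nu ^+ 2 / n.*2.+1%:R * cos_moment n.*2.+2 0 =
    2 * nu ^+ 2 * (cos_moment n.*2 0 - cos_moment n.*2.+2 0).
  have -> : cos_moment n.*2 0 = n.*2.+2%:R / n.*2.+1%:R * cos_moment n.*2.+2 0.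
    by rewrite mulrAC cos_moment_even_rec0 mulrAC divff// mul1r.
  by rewrite -[n.*2.+2%:R]natr1; field.
have mI := measurable_pihalf.
have icm := integrable_cos_moment.
have iB m1 m2 c1 c2 := integrableB mI (icm m1 c1) (icm m2 c2).
rewrite /cos_moment -!RintegralB// -RintegralZl//; last exact: iB.
apply: le_Rintegral => //; [exact: iB|exact: (integrableZl mI _ (iB _ _ _ _))|].
move=> t; rewrite /= in_itv/= => t_itv.
rewrite !mulr0 !mul0r cos0 !mulr1 !exprS.
have cos_ge0 : 0 <= cos t ^+ n.*2 by rewrite exprn_even_ge0// odd_double.
have := ler_wpM2l cos_ge0 (cos_defect_le nu t_itv); lra.
Qed.

Lemma cos_moment_ratio_cvg1 nu :
  cos_moment n.*2 nu / cos_moment n.*2 0 @[n --> \oo] --> (1 : R).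
Proof.
rewrite -cvg_shiftS.
have bound_cvg1 : 1 - 2 * nu ^+ 2 / n.*2.+1%:R @[n --> \oo] --> (1 : R).
  rewrite -[X in _ --> X]subr0 -[X in _ - X](mulr0 (2 * nu ^+ 2)).
  apply: cvgB; first exact: cvg_cst.
  apply: cvgM; first exact: cvg_cst.
  apply: (squeeze_cvgr _ (cvg_cst _) (@cvg_harmonic R)); apply: nearW => n.
  by rewrite invr_ge0 ler0n/= lef_pV2 ?posrE// ler_nat ltnS -addnn leq_addr.
apply: (squeeze_cvgr _ bound_cvg1 (cvg_cst _)); apply: nearW => n.
have moment_gt0 := cos_moment_even_gt0 n.+1; rewrite doubleS in moment_gt0 *.
rewrite ler_pdivlMr// ler_pdivrMr// mul1r; apply/andP; split.
  by rewrite mulrBl mul1r lerBlDl -lerBlDr cos_moment_defect.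
apply: le_Rintegral => //; [exact: integrable_cos_moment..|].
move=> t _; rewrite mulr0 mul0r cos0 ler_wpM2l ?cos_le1//.
by rewrite exprn_even_ge0// odd_double.
Qed.

Lemma sine_product_cvg nu : nu != 0 ->
  sine_product nu n @[n --> \oo] --> sin (nu * pi) / (nu * pi).
Proof.
move=> nu0; pose q n := cos_moment n.*2 nu / cos_moment n.*2 0.
have q_cvg := cos_moment_ratio_cvg1 nu.
have sine_productM n : sine_product nu n * q n = sin (nu * pi) / (nu * pi).
  have moment_gt0 := cos_moment_even_gt0 n; have pi0 := @pi_gt0 R.
  have := cos_moment_product nu n; rewrite cos_moment00 cos_moment0// => prodE.
  apply: (@mulIf _ (pi / 2 * cos_moment n.*2 0)).
    by rewrite mulf_neq0 ?gt_eqF// pihalf_gt0.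
  transitivity (sine_product nu n * cos_moment n.*2 nu * (pi / 2)).
    by rewrite /q; field; rewrite gt_eqF.
  rewrite prodE [RHS]mulrA; congr (_ * _).
  rewrite (mulrC nu pi) !invfM -[RHS]mulrA [in RHS]mulrACA.
  by rewrite mulVf ?gt_eqF// mul1r (mulrC 2^-1).
suff : sin (nu * pi) / (nu * pi) / q n @[n --> \oo] -->
    sin (nu * pi) / (nu * pi).
  apply: cvg_trans; apply: near_eq_cvg; near=> n.
  rewrite -(sine_productM n) mulfK//; near: n.
  exact: cvgr_neq0 q_cvg (oner_neq0 _).
rewrite -[X in _ --> X]divr1; apply: cvgM; first exact: cvg_cst.
exact: cvgV.
Unshelve. all: by end_near. Qed.

Lemma sine_productE nu n : sine_product nu n =
  pochhammer (nu + 1) n * pochhammer (1 - nu) n / pochhammer 1 n ^+ 2.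
Proof.
rewrite /sine_product /pochhammer -prodrXl -big_split/= -prodf_div.
apply: eq_bigr => k _; rewrite -natr1; field.
by rewrite nat1r pnatr_eq0.
Qed.

Lemma rgamma_sine_product nu n : (gamma (nu + 1))^-1 * (gamma (1 - nu))^-1 =
  sine_product nu n * (gamma_ratio nu n * gamma_ratio (- nu) n).
Proof.
rewrite (rgamma_pochhammer (nu + 1) n) (rgamma_pochhammer (1 - nu) n).
have -> : nu + 1 + n%:R = n.+1%:R + nu by rewrite -natr1; ring.
have -> : 1 - nu + n%:R = n.+1%:R - nu by rewrite -natr1; ring.
rewrite sine_productE /gamma_ratio gamma_nat powRN.
have poch_neq0 : pochhammer (1 : R) n != 0 by rewrite gt_eqF ?pochhammer_gt0.
have pow_neq0 : n.+1%:R `^ nu != 0 :> R by rewrite gt_eqF ?powR_gt0.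
move: (gamma _)^-1 (gamma _)^-1 => rgammaD rgammaB.
by field; rewrite poch_neq0 pow_neq0.
Qed.

Lemma gamma_reflection nu :
  (gamma (nu + 1))^-1 * (gamma (- nu))^-1 = - (sin (nu * pi) / pi).
Proof.
rewrite [(gamma (- nu))^-1]rgamma_rec (addrC (- nu)) mulrCA mulNr.
have [->|nu0] := eqVneq nu 0; first by rewrite !mul0r sin0 mul0r.
suff -> : (gamma (nu + 1))^-1 * (gamma (1 - nu))^-1 = sin (nu * pi) / (nu * pi).
  by rewrite invfM mulrCA mulVKf.
have : sine_product nu n * (gamma_ratio nu n * gamma_ratio (- nu) n)
    @[n --> \oo] --> sin (nu * pi) / (nu * pi) * (1 * 1).
  apply: cvgM; first exact: sine_product_cvg.
  by apply: cvgM; exact: gamma_ratio_cvg1.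
under eq_cvg do rewrite -rgamma_sine_product.
by move=> /(cvg_lim (@Rhausdorff R)); rewrite (lim_cst (@Rhausdorff R)) !mulr1.
Qed.

End sine_product.

(** * The Bessel-Clifford function *)
Section bessel_clifford.
Context {R : realType}.
Implicit Types (nu x y z : R).

Definition bessel_coef nu (k : nat) : R :=
  (k`!%:R * gamma (nu + k%:R + 1))^-1.

Definition bessel_clifford nu y : R := limn (pseries (bessel_coef nu) y).

Lemma rgamma_bounded nu :
  exists2 C : R, 0 <= C & forall k : nat, `|(gamma (nu + k%:R + 1))^-1| <= C.
Proof.
pose a k := `|(gamma (nu + k%:R + 1))^-1|.
pose N := (Num.truncn `|nu|).+1.
have a_nonincr k : (N <= k)%N -> a k.+1 <= a k.
  move=> Nk; rewrite /a [in leRHS]rgamma_rec normrM -natr1 addrA ler_peMl//.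
  have Nnu : - nu <= N%:R.
    by rewrite (le_trans (ler_norm (- nu)))// normrN ltW// truncnS_gt.
  have Nk' : N%:R <= k%:R :> R by rewrite ler_nat.
  by apply: le_trans (ler_norm _); lra.
exists (\sum_(k < N.+1) a k); first by apply: sumr_ge0 => k _; exact: normr_ge0.
have le_sum k : (k <= N)%N -> a k <= \sum_(k < N.+1) a k.
  move=> kN; rewrite (bigD1 (Ordinal (kN : (k < N.+1)%N)))//= lerDl.
  by apply: sumr_ge0 => i _; exact: normr_ge0.
move=> k; rewrite -/(a k); have [/le_sum//|Nk] := leqP k N.
rewrite -(subnK (ltnW Nk)); elim: (k - N)%N => [|j ih]; first exact: le_sum.
by apply: le_trans ih; rewrite addSn; apply: a_nonincr; rewrite leq_addl.
Qed.

Lemma is_cvg_bessel_clifford nu y : cvgn (pseries (bessel_coef nu) y).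
Proof.
have [C C0 rgammaC] := rgamma_bounded nu.
apply: normed_cvg; rewrite /normed_series_of /=.
apply: (@series_le_cvg _ _ (C *: exp_coeff `|y|)) => [n|n|n|].
- by [].
- by rewrite mulr_ge0 ?exp_coeff_ge0.
- rewrite /bessel_coef normrM invfM normrM normrX.
  rewrite [X in X * _ * _]ger0_norm ?invr_ge0// mulrAC mulrC.
  rewrite -[leRHS]/(C * (`|y| ^+ n / n`!%:R)) [`|y| ^+ n / _]mulrC.
  by rewrite ler_wpM2r ?mulr_ge0.
- exact: is_cvg_seriesZ (is_cvg_series_exp_coeff _).
Qed.

Lemma bessel_coef_diffs nu :
  pseries_diffs (bessel_coef nu) = bessel_coef (nu + 1).
Proof.
apply/funext => k; rewrite /pseries_diffs /bessel_coef.
rewrite (_ : nu + 1 + k%:R = nu + k.+1%:R); last by rewrite -natr1; ring.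
by rewrite factS natrM -mulrA invfM mulVKf// pnatr_eq0.
Qed.

Lemma is_derive_bessel_clifford nu y :
  is_derive y 1 (bessel_clifford nu) (bessel_clifford (nu + 1) y).
Proof.
rewrite /bessel_clifford -bessel_coef_diffs.
apply: (@pseries_snd_diffs _ _ (`|y| + 1)); rewrite ?bessel_coef_diffs;
  try exact: is_cvg_bessel_clifford.
by rewrite [ltRHS]ger0_norm ?addr_ge0// ltrDl.
Qed.

Lemma bessel_clifford_rec nu y : bessel_clifford (nu - 1) y =
  nu * bessel_clifford nu y + y * bessel_clifford (nu + 1) y.
Proof.
have coef_cvg := @is_cvg_bessel_clifford nu y.
have diffs_cvg : cvgn (pseries (pseries_diffs (bessel_coef nu)) y).
  by rewrite bessel_coef_diffs; exact: is_cvg_bessel_clifford.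
have := pseries_diffs_equiv diffs_cvg.
rewrite bessel_coef_diffs -/(bessel_clifford (nu + 1) y) => deriv_cvg.
apply: (cvg_lim (@Rhausdorff R)).
have -> : pseries (bessel_coef (nu - 1)) y =
  (fun n => nu * pseries (bessel_coef nu) y n + y *
     series (fun i => i%:R * bessel_coef nu i * y ^+ i.-1) n).
  apply/funext => n; rewrite /pseries /series /= !mulr_sumr -big_split/=.
  apply: eq_bigr => k _; rewrite /bessel_coef.
  rewrite (_ : nu - 1 + k%:R + 1 = nu + k%:R); last by ring.
  rewrite !invfM [(gamma (nu + k%:R))^-1]rgamma_rec.
  by case: k => [|k]; [rewrite !mul0r mulr0 !addr0; ring|rewrite exprS/=; ring].
apply: cvgD; (apply: cvgM; first exact: cvg_cst); [exact: coef_cvg|].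
exact: deriv_cvg.
Qed.

Definition bessel_wronskian nu y :=
  bessel_clifford nu y * bessel_clifford (- nu - 1) y -
  y * (bessel_clifford (nu + 1) y * bessel_clifford (- nu) y).

(* The derivative in y vanishes by the recurrence, and at y = 0 only the
   Gamma factors remain. *)
Lemma bessel_wronskianE nu y : bessel_wronskian nu y = - (sin (nu * pi) / pi).
Proof.
rewrite -gamma_reflection.
suff dW (u : R) : is_derive u 1 (bessel_wronskian nu) 0.
  rewrite (is_derive_0_is_cst y 0 dW) /bessel_wronskian mul0r subr0.
  by rewrite /bessel_clifford !pseries0 /bessel_coef fact0 !mul1r !addr0 subrK.
have dL w := is_derive_bessel_clifford w u.
have dwronskian := is_deriveB (is_deriveM (dL nu) (dL (- nu - 1)))
  (is_deriveM (is_derive_id u (1 : R)) (is_deriveM (dL (nu + 1)) (dL (- nu)))).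
apply: (is_derive_eq dwronskian); rewrite /GRing.scale/= !fctE mulr1 subrK.
have := bessel_clifford_rec (nu + 1) u; rewrite addrK => ->.
by rewrite (bessel_clifford_rec (- nu)); ring.
Qed.

Lemma pochhammer_ge z n : 1 <= z -> z <= pochhammer z n.+1.
Proof.
move=> z1; elim: n => [|n ih]; first by rewrite /pochhammer big_ord1 addr0.
apply: (le_trans ih); rewrite [leRHS]/pochhammer big_ord_recr/= ler_peMr//.
  by rewrite ltW// pochhammer_gt0// (lt_le_trans ltr01).
by rewrite (le_trans z1)// lerDl.
Qed.

Lemma gammaM_bessel_coef z k : 0 <= z ->
  gamma (z + 1) * bessel_coef z k = (k`!%:R * pochhammer (z + 1) k)^-1.
Proof.
move=> z0; have z10 : 0 < z + 1 by rewrite ltr_wpDl.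
rewrite /bessel_coef addrAC gamma_pochhammer// !invfM.
by rewrite [LHS]mulrC -!mulrA mulVf ?mulr1// gt_eqF ?gamma_gt0.
Qed.

Lemma gammaM_pseries_bounds z y n : 0 <= z -> 0 < y ->
  1 <= gamma (z + 1) * pseries (bessel_coef z) y n.+1 <= 1 + expR y / (z + 1).
Proof.
move=> z0 y0; have z10 : 0 < z + 1 by rewrite ltr_wpDl.
have coef_ge0 k : 0 <= exp_coeff y k by rewrite exp_coeff_ge0// ltW.
have -> : gamma (z + 1) * pseries (bessel_coef z) y n.+1 =
    1 + \sum_(0 <= k < n) exp_coeff y k.+1 / pochhammer (z + 1) k.+1.
  rewrite /pseries /series/= mulr_sumr big_nat_recl//= mulrA.
  rewrite gammaM_bessel_coef// /pochhammer big_ord0 fact0 !mulr1 invr1.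
  congr (_ + _).
  apply: eq_bigr => k _; rewrite mulrA gammaM_bessel_coef// /exp_coeff/= invfM.
  by rewrite mulrAC (mulrC _ (y ^+ _)).
have p0 k : 0 < pochhammer (z + 1) k by exact: pochhammer_gt0.
rewrite lerDl sumr_ge0/= => [|k _]; last by rewrite divr_ge0// ltW.
rewrite lerD2l.
apply: (@le_trans _ _ ((\sum_(0 <= k < n) exp_coeff y k.+1) / (z + 1))).
  rewrite mulr_suml; apply: ler_sum => k _.
  by rewrite ler_wpM2l// lef_pV2 ?posrE// pochhammer_ge// lerDr.
rewrite ler_pM2r ?invr_gt0//.
have : series (exp_coeff y) n.+1 <= expR y.
  apply: nondecreasing_cvgn_le; last exact: is_cvg_series_exp_coeff.
  by apply: nondecreasing_series => k _ _; exact: coef_ge0.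
by apply: le_trans; rewrite /series/= big_nat_recl//= lerDr.
Qed.

Lemma gammaM_bessel_clifford_cvg1 y : 0 < y ->
  gamma (z + 1) * bessel_clifford z y @[z --> +oo] --> (1 : R).
Proof.
move=> y0; have bound_cvg1 : 1 + expR y / (z + 1) @[z --> +oo] --> (1 : R).
  rewrite -[X in _ --> X]addr0 -[X in _ + X](mulr0 (expR y)).
  apply: cvgD; first exact: cvg_cst.
  apply: cvgM; first exact: cvg_cst.
  exact: (cvg_shift_pinfty 1 cvg_inv_pinfty).
apply: (squeeze_cvgr _ (cvg_cst _) bound_cvg1); near=> z.
have z0 : 0 <= z by near: z; exact: nbhs_pinfty_ge.
have lim_cvg : gamma (z + 1) * pseries (bessel_coef z) y n.+1 @[n --> \oo] -->
    gamma (z + 1) * bessel_clifford z y.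
  apply: cvgM; first exact: cvg_cst.
  by have := @is_cvg_bessel_clifford z y; rewrite -cvg_shiftS.
rewrite -(cvg_lim (@Rhausdorff R) lim_cvg); apply/andP; split.
  apply: limr_ge; first exact: cvgP lim_cvg.
  by apply: nearW => n; case/andP: (gammaM_pseries_bounds n z0 y0).
apply: limr_le; first exact: cvgP lim_cvg.
by apply: nearW => n; case/andP: (gammaM_pseries_bounds n z0 y0).
Unshelve. all: by end_near. Qed.

Lemma besselIE nu x : 0 < x ->
  besselI nu x = (x / 2) `^ nu * bessel_clifford nu ((x / 2) ^+ 2).
Proof.
move=> x0; have x20 : 0 < x / 2 by rewrite divr_gt0.
rewrite /besselI; apply: (cvg_lim (@Rhausdorff R)).
have -> : series (fun k : nat =>
    (x / 2) `^ (k.*2%:R + nu) / (k`!%:R * gamma (nu + k%:R + 1))) =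
  (fun n => (x / 2) `^ nu * pseries (bessel_coef nu) ((x / 2) ^+ 2) n).
  apply/funext => n; rewrite /pseries /series/= mulr_sumr.
  apply: eq_bigr => k _; rewrite gt0_powRD// powR_mulrn ?ltW//.
  rewrite -exprM -muln2 mulnC.
  by rewrite /bessel_coef; ring.
by apply: cvgM; [exact: cvg_cst|exact: is_cvg_bessel_clifford].
Qed.

End bessel_clifford.

(** * The integral representation of K *)
Section macdonald_bessel.
Context {R : realType}.
Implicit Types (nu x y z : R).

Definition casoratian y nu := macdonald y (nu + 1) * bessel_clifford nu y +
  y * (macdonald y nu * bessel_clifford (nu + 1) y).

Lemma casoratian_periodic y : 0 < y -> periodic (casoratian y) 1.
Proof.
move=> y0 nu; have M_rec := macdonald_rec (macdonald_dom_gt0 (nu + 1) y0).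
have L_rec := bessel_clifford_rec (nu + 1) y; rewrite addrK in M_rec, L_rec.
by rewrite /casoratian M_rec L_rec; ring.
Qed.

Lemma casoratian_cvg1 y : 0 < y -> casoratian y z @[z --> +oo] --> (1 : R).
Proof.
move=> y0; have M_cvg := macdonald_div_gamma_cvg1 y0.
have L_cvg := gammaM_bessel_clifford_cvg1 y0.
have inv_cvg := @cvg_inv_pinfty R.
have : macdonald y (z + 1) / gamma (z + 1) *
      (gamma (z + 1) * bessel_clifford z y) +
    y * (z^-1 * (z + 1)^-1 * (macdonald y z / gamma z *
      (gamma (z + 1 + 1) * bessel_clifford (z + 1) y))) @[z --> +oo] -->
    1 * 1 + y * (0 * 0 * (1 * 1)).
  apply: cvgD; first by apply: cvgM => //; exact: cvg_shift_pinfty M_cvg.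
  apply: cvgM; first exact: cvg_cst.
  apply: cvgM; first by apply: cvgM => //; exact: cvg_shift_pinfty inv_cvg.
  by apply: cvgM => //; exact: (cvg_shift_pinfty 1 L_cvg).
rewrite !mul1r !mul0r mulr0 addr0.
apply: cvg_trans; apply: near_eq_cvg; near=> z.
have z0 : 0 < z by near: z; exact: nbhs_pinfty_gt.
have z10 : 0 < z + 1 by rewrite addr_gt0.
have g0 := gamma_gt0 z0.
by rewrite /casoratian !gammaS//; field; rewrite !gt_eqF.
Unshelve. all: by end_near. Qed.

Lemma casoratian_eq1 y nu : 0 < y -> casoratian y nu = 1.
Proof.
move=> y0; apply: (@periodic_cvg_pinfty _ _ 1) => //.
  exact: casoratian_periodic.
exact: casoratian_cvg1.
Qed.

(* The Casoratian identity at - nu - 1, rewritten with macdonaldN. *)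
Lemma casoratian_reflected y nu : 0 < y ->
  macdonald y nu * bessel_clifford (- nu - 1) y +
  macdonald y (nu + 1) * bessel_clifford (- nu) y = y `^ nu.
Proof.
move=> y0; have y_neq0 : y != 0 by rewrite gt_eqF.
have pow_neq0 : y `^ nu != 0 by rewrite gt_eqF ?powR_gt0.
have powE : y `^ (- (nu + 1)) = (y `^ nu)^-1 / y.
  by rewrite powRN gt0_powRD// (powRr1 (ltW y0)) invfM.
have := casoratian_eq1 (- nu - 1) y0.
rewrite /casoratian subrK -opprD !macdonaldN// powE powRN opprD => casE.
rewrite -[RHS]mulr1 -[X in _ = _ * X]casE.
by field; rewrite y_neq0 pow_neq0.
Qed.

Lemma macdonald_wronskian y nu : 0 < y ->
  macdonald y nu * bessel_wronskian nu y =
  y `^ nu * bessel_clifford nu y - bessel_clifford (- nu) y.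
Proof.
move=> y0; rewrite -(casoratian_reflected nu y0).
rewrite -[X in _ = _ - X]mul1r -[X in _ - X * _](casoratian_eq1 nu y0).
by rewrite /bessel_wronskian /casoratian; ring.
Qed.

Lemma macdonaldM_sin y nu : 0 < y ->
  macdonald y nu * sin (nu * pi) =
  pi * (bessel_clifford (- nu) y - y `^ nu * bessel_clifford nu y).
Proof.
move=> y0; have := macdonald_wronskian nu y0.
rewrite bessel_wronskianE mulrN => /(congr1 -%R); rewrite opprK opprB => <-.
by rewrite mulrCA [pi * _]mulrC divfK// gt_eqF ?pi_gt0.
Qed.

Lemma besselK_nonintE nu x : 0 < x -> nu \isn't a Num.int ->
  besselK_nonint nu x = (x / 2) `^ (- nu) * macdonald ((x / 2) ^+ 2) nu / 2.
Proof.
move=> x0 nu_int; have x20 : 0 < x / 2 by rewrite divr_gt0.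
have s_neq0 := sin_pi_neq0 nu_int.
have pow_neq0 : (x / 2) `^ nu != 0 by rewrite gt_eqF ?powR_gt0.
have := macdonaldM_sin nu (exprn_gt0 2 x20).
rewrite /besselK_nonint !besselIE// powRN {2}expr2.
rewrite (powRM _ (ltW x20) (ltW x20)).
move=> /(canRL (mulfK s_neq0)) ->.
by field; rewrite s_neq0 pow_neq0.
Qed.

Lemma besselKE nu x : 0 < x ->
  besselK nu x = (x / 2) `^ (- nu) * macdonald ((x / 2) ^+ 2) nu / 2.
Proof.
move=> x0; rewrite /besselK.
case: ifPn => [nu_int|]; last exact: besselK_nonintE.
have x20 : 0 < x / 2 by rewrite divr_gt0.
apply: (cvg_lim (@Rhausdorff R)).
suff : (x / 2) `^ (- mu) * macdonald ((x / 2) ^+ 2) mu / 2 @[mu --> nu^'] -->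
    (x / 2) `^ (- nu) * macdonald ((x / 2) ^+ 2) nu / 2.
  apply: cvg_trans; apply: near_eq_cvg.
  apply: filterS (punctured_nbhs_nonint nu_int) => mu mu_nonint.
  by rewrite besselK_nonintE.
apply/continuous_withinNx.
apply: cvgM; last exact: cvg_cst.
apply: cvgM; last by apply: macdonald_continuous; rewrite exprn_gt0.
rewrite /powR gt_eqF//; apply: continuous_cvg; first exact: continuous_expR.
by apply: cvgM; [apply: cvgN; exact: cvg_id|exact: cvg_cst].
Qed.

End macdonald_bessel.

(** * Log-convexity of the product *)
Section bessel_product.
Context {R : realType}.
Implicit Types (nu x y z c : R).

Lemma gamma_quotient_rec c z : 0 < c -> 0 < z ->
  (z + c) / z * (gamma (z + 1) / gamma (z + 1 + c)) = gamma z / gamma (z + c).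
Proof.
move=> c0 z0; have zc : 0 < z + c by rewrite addr_gt0.
rewrite (addrAC z 1) !gammaS//; have := gamma_gt0 zc.
by move: (gamma _) (gamma _) => g1 g2 g0; field; rewrite !gt_eqF.
Qed.

Lemma gamma_quotient_cvg c z : 0 < c -> 0 < z ->
  n.+1%:R `^ (- c) * \prod_(k < n.+1) ((z + k%:R + c) / (z + k%:R))
    @[n --> \oo] --> gamma z / gamma (z + c).
Proof.
move=> c0 z0; have zc : 0 < z + c by rewrite addr_gt0.
have : gamma z / gamma (z + c) * (gamma_ratio z n / gamma_ratio (z + c) n)
    @[n --> \oo] --> gamma z / gamma (z + c) * (1 / 1).
  apply: cvgM; first exact: cvg_cst.
  by apply: cvgM; [|apply: cvgV => //]; exact: gamma_ratio_cvg1.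
rewrite divr1 mulr1; apply: cvg_trans; apply: near_eq_cvg; apply: nearW => n.
have -> : \prod_(k < n.+1) ((z + k%:R + c) / (z + k%:R)) =
    pochhammer (z + c) n.+1 / pochhammer z n.+1.
  by rewrite -prodf_div; apply: eq_bigr => k _; rewrite addrAC.
rewrite /gamma_ratio ![n.+1%:R + _]addrC !gamma_pochhammer// gt0_powRD// powRN.
have P0 := pochhammer_gt0 n.+1 z0; have Pc0 := pochhammer_gt0 n.+1 zc.
have g0 := gamma_gt0 z0; have gc0 := gamma_gt0 zc.
have gn0 := @gamma_gt0 R n.+1%:R (ltr0Sn _ _).
have pz0 := @powR_gt0 R n.+1%:R z (ltr0Sn _ _).
have pc0 := @powR_gt0 R n.+1%:R c (ltr0Sn _ _).
by field; rewrite !gt_eqF.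
Qed.

Lemma gamma_quotient_log_convex c : 0 < c ->
  log_convex_on `]0, +oo[ (fun z => gamma z / gamma (z + c)).
Proof.
move=> c0; apply: log_convex_on_lim => [z|z|n].
- by rewrite in_itv/= andbT => z0; rewrite divr_gt0 ?gamma_gt0// addr_gt0.
- by rewrite in_itv/= andbT => z0; exact: gamma_quotient_cvg.
apply: lteif_log_convex_onZ; first by rewrite powR_gt0.
apply: (log_convex_on_prod _
  (F := fun k z => (z + k%:R + c) / (z + k%:R))) => k.
apply: (lteif_log_convex_on_shift (f := fun z => (z + c) / z) (j := `]0, +oo[)).
  by move=> z; rewrite !in_itv/= !andbT => z0; rewrite ltr_wpDr.
exact: (log_convex_onW (C := false)) (strictly_log_convex_on_ratio c0).
Qed.

Lemma gamma_quotient_strictly_log_convex c : 0 < c ->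
  strictly_log_convex_on `]0, +oo[ (fun z => gamma z / gamma (z + c)).
Proof.
move=> c0; apply: (eq_lteif_log_convex_on (C := false)
  (f := fun z => (z + c) / z * (gamma (z + 1) / gamma (z + 1 + c)))).
  by move=> z; rewrite in_itv/= andbT => z0; exact: gamma_quotient_rec.
apply: strictly_log_convex_onM; first exact: strictly_log_convex_on_ratio.
apply: (lteif_log_convex_on_shift (f := fun z => gamma z / gamma (z + c))
  (j := `]0, +oo[)); last exact: gamma_quotient_log_convex.
by move=> z; rewrite !in_itv/= !andbT => z0; rewrite addr_gt0.
Qed.

Definition bessel_term y (k : nat) nu : R := y ^+ k / k`!%:R *
  (gamma (nu + 1 / 2) / gamma (nu + 1 / 2 + (k%:R + 1 / 2))).

Lemma bessel_term_series_cvg y nu : series (bessel_term y ^~ nu) @ \oo -->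
  gamma (nu + 1 / 2) * bessel_clifford nu y.
Proof.
have -> : series (bessel_term y ^~ nu) =
    (fun n => gamma (nu + 1 / 2) * pseries (bessel_coef nu) y n).
  apply/funext => n; rewrite /pseries /series/= mulr_sumr.
  apply: eq_bigr => k _; rewrite /bessel_term /bessel_coef.
  rewrite (_ : nu + 1 / 2 + (k%:R + 1 / 2) = nu + k%:R + 1); last by field.
  by rewrite invfM; ring.
by apply: cvgM; [exact: cvg_cst|exact: is_cvg_bessel_clifford].
Qed.

Lemma bessel_term_lteif_log_convex C y k : 0 < y ->
  lteif_log_convex_on C `]0, +oo[
    (fun z => gamma z / gamma (z + (k%:R + 1 / 2))) ->
  lteif_log_convex_on C `](- (1 / 2)), +oo[ (bessel_term y k).
Proof.
move=> y0 quotient; apply: lteif_log_convex_onZ.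
  by rewrite divr_gt0 ?exprn_gt0// ltr0n fact_gt0.
apply: (lteif_log_convex_on_shift _ quotient) => nu.
by rewrite !in_itv/= !andbT; lra.
Qed.

Lemma gammaM_bessel_clifford_strictly_log_convex y : 0 < y ->
  strictly_log_convex_on `](- (1 / 2)), +oo[
    (fun nu => gamma (nu + 1 / 2) * bessel_clifford nu y).
Proof.
move=> y0; have half_gt0 k : 0 < k%:R + 1 / 2 :> R by rewrite ltr_wpDl.
apply: (eq_lteif_log_convex_on (C := false)
  (f := fun nu => limn (series (bessel_term y ^~ nu)))).
  move=> nu _; apply: (cvg_lim (@Rhausdorff R)).
  exact: bessel_term_series_cvg.
apply: (lteif_log_convex_on_series (C := false)) => [|k|nu _].
- apply: (bessel_term_lteif_log_convex (C := false)) => //.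
  exact: gamma_quotient_strictly_log_convex (half_gt0 0%N).
- apply: bessel_term_lteif_log_convex => //.
  exact: gamma_quotient_log_convex (half_gt0 k.+1).
- by apply: cvgP; exact: bessel_term_series_cvg.
Qed.

Lemma calPE nu x : 0 < x -> calP nu x =
  gamma (nu + 1 / 2) * bessel_clifford nu ((x / 2) ^+ 2) *
  (Num.sqrt pi / 4 * (x^-1 `^ nu * macdonald ((x / 2) ^+ 2) nu)).
Proof.
move=> x0; rewrite /calP /besselP besselIE// besselKE// powRN.
have xnu0 : x `^ nu != 0 by rewrite gt_eqF ?powR_gt0.
have x2nu0 : (x / 2) `^ nu != 0 by rewrite gt_eqF ?powR_gt0 ?divr_gt0.
rewrite -(powR_inv1 (ltW x0)) -powRrM mulN1r powRN.
by field; rewrite xnu0.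
Qed.

End bessel_product.

Theorem theorem6 (R : realType) (x : R) (hx : 0 < x) :
  strictly_log_convex_on `](- (1 / 2)), +oo[ (fun nu : R => calP nu x).
Proof.
have y0 : 0 < (x / 2) ^+ 2 by rewrite exprn_gt0// divr_gt0.
rewrite (funext (fun nu => calPE nu hx)); apply: strictly_log_convex_onM.
  exact: gammaM_bessel_clifford_strictly_log_convex.
apply: lteif_log_convex_onZ; first by rewrite divr_gt0// sqrtr_gt0 pi_gt0.
apply: (lteif_log_convex_onM (C1 := true) (C2 := true)).
  by apply: log_convex_on_powR; rewrite invr_gt0.
by apply: macdonald_log_convex => z _; exact: macdonald_dom_gt0.
Qed.
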